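(* Let $f$ be any continuous, strictly convex or strictly concave function on $\mathbb{R}$, and let $A,C\subset \mathbb{R}$ be any finite sets with $|A|=|C|$. Then $$|f(A)+C|^{42}\, |A+A|^{37} \gg |A|^{100} \log^{-20} |A| .$$ In particular, taking $C=f(A)$, $$\max\{ |f(A)+f(A)|, |A+A| \} \gg |A|^{\frac{100}{79}} \log^{-\frac{20}{79}} |A| .$$ Finally, $$|AA|^{42}\, |A+A|^{37} \gg |A|^{100} \log^{-20} |A| .$$
   Context: For sets $X,Y\subset\mathbb{R}$, $X+Y=\{x+y: x\in X, y\in Y\}$, $XY=\{xy : x\in X,y\in Y\}$, and $f(A)=\{f(a):a\in A\}$. The symbols $\ll,\gg$ denote inequalities up to absolute positive constants. Logarithms are base 2. *)

(* Defs.v *)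
From HB Require Import structures.
From mathcomp Require Import all_boot all_order all_algebra finmap.
From mathcomp Require Import all_classical all_reals all_analysis.

Set Implicit Arguments.
Unset Strict Implicit.
Unset Printing Implicit Defensive.

Import Order.TTheory GRing.Theory Num.Theory.
Import numFieldNormedType.Exports.

Local Open Scope fset_scope.
Local Open Scope ring_scope.

Definition sumset (R : realType) (X Y : {fset R}) : {fset R} :=
  [fset x + y | x in X, y in Y].

Definition prodset (R : realType) (X Y : {fset R}) : {fset R} :=
  [fset x * y | x in X, y in Y].

Definition strictly_convex (R : realType) (f : R -> R) : Prop :=
  forall x y t : R, x != y -> 0 < t -> t < 1 ->
    f (t * x + (1 - t) * y) < t * f x + (1 - t) * f y.

Definition strictly_concave (R : realType) (f : R -> R) : Prop :=
  forall x y t : R, x != y -> 0 < t -> t < 1 ->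
    t * f x + (1 - t) * f y < f (t * x + (1 - t) * y).

Definition cardR (R : realType) (A : {fset R}) : R := #|` A|%:R.

(* Base 2 logarithm. It vanishes at cardR A when A has at most one element
   (ln 1 = 0, and ln 0 = 0 by convention); since 0^-1 = 0 and 0 `^ a = 0 for
   a != 0, its negative powers are then 0 as well, so a lower bound having one
   of them as a factor has content only for sets with at least two elements. *)
Definition log2 (R : realType) (x : R) : R := ln x / ln 2.

(* Main.v *)
Require Import Defs.
From HB Require Import structures.
From mathcomp Require Import all_boot all_order all_algebra finmap.
From mathcomp Require Import all_classical all_reals all_analysis.
From mathcomp Require Import ring lra.
From mathcomp Require Import zify.

Set Implicit Arguments.
Unset Strict Implicit.
Unset Printing Implicit Defensive.

Import Order.TTheory GRing.Theory Num.Theory.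
Import numFieldNormedType.Exports.

Local Open Scope ring_scope.

(* Write n = |A|, S = A + A, F = f(A) + C and r(x) = r_{A-A}(x).

   Passing to half of A we may assume that f is monotone on A.  Then the
   translates of its graph are monotone curves of which two distinct ones share
   at most one point, so a cell decomposition of the grid X * F gives
   a Szemeredi-Trotter bound: for every finite B, r_{A-B} >= t holds on a set X
   only if t^3 |X| << T |B|^2, with T = |F|^2 / |C|.  Consequently
   E(A, B)^2 << T n |B|^3 and E_3(A) << T n^2 log n.

   Let Q be the set of sums in S with at least n^2 / (2|S|) representations, and
   let N be the sum of r(x - y) over x, y, z in A with x + z and y + z in Q.
   As r(x - y) is positive definite, N >> n^5 / |S|.  On the other hand, N^2 is
   at most E_3(A) times the sum of r(q - q')^2 over q, q' in Q, and the latter is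
   estimated from the Szemeredi-Trotter bound and from the popularity of Q.
   Together this gives n^79 << T^21 |S|^37 log^10 n.

   For products the same argument applies to f = log |.| on the elements of A
   of one sign. *)

(** * Representation functions and dyadic layers *)

Section Counting.
Variable R : realType.
Implicit Types (A B D X : {fset R}) (x y : R).

Lemma ler_sum_mem (I : eqType) (s : seq I) (F G : I -> R) :
  (forall i, i \in s -> F i <= G i) ->
  \sum_(i <- s) F i <= \sum_(i <- s) G i.
Proof. by move=> le; rewrite big_seq [leRHS]big_seq; apply: ler_sum. Qed.

(** Writing a membership indicator as a sum of equality indicators lets representation counts be
    summed in another order. *)
Lemma sum_mem_delta (I : choiceType) (X : {fset I}) (y : I) (h : I -> R) :
  \sum_(x <- X) (x == y)%:R * h x = (y \in X)%:R * h y.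
Proof.
have [yX|yX] := boolP (y \in X).
  rewrite (big_fsetD1 y) //= eqxx big_seq big1 ?addr0 // => x.
  by rewrite in_fsetD1 => /andP[/negPf-> _]; rewrite mul0r.
rewrite mul0r big_seq big1 // => x xX.
by have [xy|_] := eqVneq x y; [rewrite -xy xX in yX | rewrite mul0r].
Qed.

Lemma cardR_sum X : cardR X = \sum_(x <- X) 1.
Proof. by rewrite /cardR big_const_seq count_predT iter_addr_0. Qed.

Lemma cardR_filter X (P : pred R) :
  cardR [fset x in X | P x]%fset = \sum_(x <- X) (P x)%:R.
Proof.
rewrite cardR_sum -big_fset_condE big_mkcond /=.
by apply: eq_bigr => x _; case: (P x).
Qed.

Lemma cardR_ge0 X : 0 <= cardR X.
Proof. exact: ler0n. Qed.

(** Lagrange's identity: the double sum of [(F i * G j - F j * G i) ^+ 2] is twice the difference of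
    the two sides. *)
Lemma cauchy_schwarz (I : Type) (s : seq I) (F G : I -> R) :
  (\sum_(i <- s) F i * G i) ^+ 2
  <= (\sum_(i <- s) F i ^+ 2) * (\sum_(i <- s) G i ^+ 2).
Proof.
have : 0 <= \sum_(i <- s) \sum_(j <- s) (F i * G j - F j * G i) ^+ 2.
  by do 2!(apply: sumr_ge0 => ? _); apply: sqr_ge0.
have -> : \sum_(i <- s) \sum_(j <- s) (F i * G j - F j * G i) ^+ 2 =
  \sum_(i <- s) (F i ^+ 2 * (\sum_(j <- s) G j ^+ 2)
   + (\sum_(j <- s) F j ^+ 2) * G i ^+ 2
   + (- 2 * (\sum_(j <- s) F j * G j)) * (F i * G i)).
  apply: eq_bigr => i _.
  rewrite !mulr_sumr !mulr_suml -!big_split /=.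
  by apply: eq_bigr => j _; ring.
rewrite !big_split /= -!mulr_sumr -!mulr_suml; lra.
Qed.

(* r_{A-B}(x): a pair (a, b) with a - b = x is encoded by its second member. *)
Definition rep A B x : R := \sum_(b <- B) (x + b \in A)%:R.

Definition diffset A B : {fset R} := [fset a - b | a in A, b in B]%fset.

Lemma rep_ge0 A B x : 0 <= rep A B x.
Proof. by apply: sumr_ge0 => b _; apply: ler0n. Qed.

Lemma mem_diffset A B a b : a \in A -> b \in B -> a - b \in diffset A B.
Proof. by move=> aA bB; apply/imfset2P; exists a => //; exists b. Qed.

Lemma mem_sumset A B a b : a \in A -> b \in B -> a + b \in sumset A B.
Proof. by move=> aA bB; apply/imfset2P; exists a => //; exists b. Qed.

(** [D] may be any set containing the differences, so that two representation functions can be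
    summed over a common set. *)
Lemma sum_rep_mul A B D (h : R -> R) :
  (forall a b, a \in A -> b \in B -> a - b \in D) ->
  \sum_(x <- D) rep A B x * h x = \sum_(a <- A) \sum_(b <- B) h (a - b).
Proof.
move=> memD; rewrite exchange_big /=.
under eq_bigr do rewrite mulr_suml.
rewrite exchange_big /= big_seq [RHS]big_seq; apply: eq_bigr => b bB.
transitivity (\sum_(x <- D) \sum_(a <- A) (a == x + b)%:R * h (a - b)).
  apply: eq_bigr => x _; rewrite (sum_mem_delta A (x + b) (fun a => h (a - b))).
  by rewrite addrK.
rewrite exchange_big /= big_seq [RHS]big_seq; apply: eq_bigr => a aA.
under eq_bigr do rewrite -subr_eq eq_sym.
by rewrite (sum_mem_delta D (a - b) (fun=> h (a - b))) memD // mul1r.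
Qed.

Lemma sum_rep A B D :
  (forall a b, a \in A -> b \in B -> a - b \in D) ->
  \sum_(x <- D) rep A B x = cardR A * cardR B.
Proof.
move=> /(@sum_rep_mul A B D (fun=> 1)); under eq_bigr do rewrite mulr1.
move=> ->; rewrite !cardR_sum mulr_suml; apply: eq_bigr => a _.
by rewrite mul1r.
Qed.

Lemma rep_le A B x : rep A B x <= cardR B.
Proof. by rewrite cardR_sum; apply: ler_sum => b _; rewrite lern1 leq_b1. Qed.

Lemma repN A B x : rep B A (- x) = rep A B x.
Proof.
rewrite /rep.
transitivity (\sum_(a <- A) \sum_(b <- B) (b == - x + a)%:R * 1 : R).
  by apply: eq_bigr => a _; rewrite (sum_mem_delta B (- x + a) (fun=> 1)) mulr1.
rewrite exchange_big /=; apply: eq_bigr => b _.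
rewrite -[RHS]mulr1 -(sum_mem_delta A (x + b) (fun=> 1)).
by apply: eq_bigr => a _; rewrite addrC -subr_eq opprK addrC eq_sym.
Qed.

Lemma rep_le_left A B x : rep A B x <= cardR A.
Proof. by rewrite -repN rep_le. Qed.

Definition energy A B : R := \sum_(x <- diffset A B) rep A B x ^+ 2.

Lemma energyE A B : energy A B = \sum_(a <- A) \sum_(b <- B) rep A B (a - b).
Proof.
rewrite /energy; under eq_bigr do rewrite expr2.
exact: (sum_rep_mul _ (@mem_diffset A B)).
Qed.

Lemma rep_diffset A B x : x \notin diffset A B -> rep A B x = 0.
Proof.
move=> xD; rewrite /rep big_seq big1 // => b bB.
have [xbA|//] := boolP (x + b \in A); case/negP: xD.
by rewrite -(addrK b x) mem_diffset.
Qed.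

Lemma energy_superset A B D :
  (forall a b, a \in A -> b \in B -> a - b \in D) ->
  \sum_(x <- D) rep A B x ^+ 2 = energy A B.
Proof.
move=> memD; rewrite energyE; under eq_bigr do rewrite expr2.
exact: sum_rep_mul memD.
Qed.

(** Some layer [q ^+ j * d <= r < q ^+ j.+1 * d] contains [r], and its term alone is at least
    [r ^+ p]. The induction tests the top layer first. *)
Lemma power_le_layers (q d r : R) (p J : nat) :
  0 < q -> 0 < d -> d <= r -> r < q ^+ J * d ->
  r ^+ p <= \sum_(j < J) (q ^+ j.+1 * d) ^+ p * (q ^+ j * d <= r)%R%:R.
Proof.
move=> q0 d0 dr; elim: J => [|J IH].
  by rewrite expr0 mul1r ltNge dr.
move=> rJ; rewrite big_ord_recr /=.
have [lt|ge] := ltP r (q ^+ J * d).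
  by rewrite mulr0 addr0 IH.
rewrite mulr1 -[leLHS]add0r; apply: lerD.
  apply: sumr_ge0 => j _; rewrite mulr_ge0 ?ler0n // exprn_ge0 //.
  by rewrite mulr_ge0 ?ltW // exprn_gt0.
have r0 : 0 <= r by apply: ltW; apply: lt_le_trans dr.
have u0 : 0 <= q ^+ J.+1 * d by rewrite mulr_ge0 ?exprn_ge0 ?ltW.
by rewrite lerXn2r // ltW.
Qed.

(** This turns bounds for level sets into bounds for moments; the values below [d] are left for
    separate treatment. *)
Lemma sum_power_le_layers (I : eqType) (s : seq I) (r : I -> R) (q d : R)
    (p J : nat) :
  0 < q -> 0 < d -> (forall i, i \in s -> r i < q ^+ J * d) ->
  \sum_(i <- s) r i ^+ p * (d <= r i)%R%:R
  <= \sum_(j < J) (q ^+ j.+1 * d) ^+ p * \sum_(i <- s) (q ^+ j * d <= r i)%R%:R.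
Proof.
move=> q0 d0 rJ; under [leRHS]eq_bigr do rewrite mulr_sumr.
rewrite exchange_big /=; apply: ler_sum_mem => i si.
have [dr|_] := leP d (r i); last first.
  rewrite mulr0; apply: sumr_ge0 => j _; rewrite mulr_ge0 ?ler0n //.
  by rewrite exprn_ge0 // mulr_ge0 ?ltW // exprn_gt0.
by rewrite mulr1; apply: power_le_layers (rJ i si).
Qed.

Lemma root_exists (k : nat) (x : R) : (0 < k)%N -> 0 < x ->
  exists2 y : R, 0 < y & y ^+ k = x.
Proof.
move=> k0 x0; exists (x `^ (k%:R^-1)); first exact: powR_gt0.
rewrite -powR_mulrn ?powR_ge0 // -powRrM mulVf ?powRr1 ?ltW //.
by rewrite pnatr_eq0 -lt0n.
Qed.

Lemma exists_exp_gt (q x : R) : 2 <= q -> exists J : nat, x < q ^+ J.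
Proof.
move=> q2; exists (Num.bound `|x|).
have: `|x| < (Num.bound `|x|)%:R by apply: archi_boundP; exact: normr_ge0.
move=> /(le_lt_trans (ler_norm _)) /lt_le_trans -> //.
apply: le_trans (_ : 2 ^+ Num.bound `|x| <= _).
  by rewrite -natrX ler_nat ltnW // ltn_expl.
by rewrite lerXn2r // nnegrE; lra.
Qed.

Lemma cardR_gt0 A : A != fset0%fset -> 0 < cardR A.
Proof. by rewrite ltr0n cardfs_gt0. Qed.

Lemma rep_nat A B x : exists k : nat, rep A B x = k%:R.
Proof. by exists (\sum_(b <- B) (x + b \in A)%R)%N; rewrite natr_sum. Qed.

End Counting.

(** * Energies of Szemeredi-Trotter sets *)

Section Energy.
Variable R : realType.
Implicit Types (A B D X Q : {fset R}) (x y T : R).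

(* A is a Szemeredi-Trotter set with parameter D(A) = T / |A|. *)
Definition st_type A T : Prop := forall B X (t : R), 0 < t ->
  (forall x, x \in X -> t <= rep A B x) ->
  t ^+ 3 * cardR X <= T * cardR B ^+ 2.

Lemma sum_half_le (J : nat) : \sum_(j < J) (2^-1 : R) ^+ j <= 2.
Proof.
suff -> : \sum_(j < J) (2^-1 : R) ^+ j = 2 - 2 * 2^-1 ^+ J.
  by rewrite lerBlDr lerDl mulr_ge0 ?exprn_ge0.
elim: J => [|J IH]; first by rewrite big_ord0 expr0; lra.
rewrite big_ord_recr /= IH exprS; set u := _ ^+ J; lra.
Qed.

Lemma st_type_level A T B D (t : R) : st_type A T -> 0 < t ->
  t ^+ 3 * (\sum_(x <- D) (t <= rep A B x)%R%:R) <= T * cardR B ^+ 2.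
Proof.
move=> stA t0; rewrite -(cardR_filter D (fun x => t <= rep A B x)).
by apply: stA => // x; rewrite !inE => /andP[].
Qed.

(** Values of [rep A B] below [d] contribute at most [d |A| |B|], the dyadic layers above [d] at
    most [8 T |B|^2 / d]. The choice [d^2 = T |B| / |A|] makes the two comparable, and 81 is the
    square of 1 + 8. *)
Lemma energy_bound A B T : st_type A T -> 0 < T ->
  energy A B ^+ 2 <= 81 * T * cardR A * cardR B ^+ 3.
Proof.
move=> stA T0.
have [->|/cardR_gt0 a0] := eqVneq A fset0%fset.
  by rewrite energyE big_seq_fset0 expr0n /= /cardR cardfs0 mulr0 mul0r.
have [->|/cardR_gt0 b0] := eqVneq B fset0%fset.
  rewrite energyE big1 => [|x _]; last by rewrite big_seq_fset0.
  by rewrite expr0n /= /cardR cardfs0 expr0n /= mulr0.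
set a := cardR A in a0 *; set b := cardR B in b0 *.
have [d d0 dE] : exists2 d : R, 0 < d & d ^+ 2 = T * b / a.
  by apply: root_exists; rewrite // divr_gt0 // mulr_gt0.
have dEa : d ^+ 2 * a = T * b by rewrite dE divfK ?gt_eqF.
have [J bJ] : exists J : nat, b / d < 2 ^+ J by exact: exists_exp_gt.
have repJ x : x \in diffset A B -> rep A B x < 2 ^+ J * d.
  by move=> _; apply: le_lt_trans (rep_le A B x) _; rewrite -ltr_pdivrMr.
have small : \sum_(x <- diffset A B) d * rep A B x = d * (a * b).
  by rewrite -mulr_sumr sum_rep //; exact: mem_diffset.
have large := @sum_power_le_layers R R (diffset A B) (rep A B) 2 d 2 J
  ltac:(lra) d0 repJ.
have : d * \sum_(j < J) (2 ^+ j.+1 * d) ^+ 2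
            * \sum_(x <- diffset A B) (2 ^+ j * d <= rep A B x)%R%:R
       <= 8 * T * b ^+ 2.
  (* The level bound decays like [8 ^ (- j)] against weights [4 ^ j], which leaves a geometric
     series. *)
  apply: le_trans (_ : \sum_(j < J) (4 * T * b ^+ 2) * (2^-1) ^+ j <= _).
    rewrite mulr_sumr; apply: ler_sum => j _.
    have u0 : 0 < 2 ^+ j :> R by rewrite exprn_gt0.
    have := st_type_level B (diffset A B) stA (mulr_gt0 u0 d0).
    rewrite -/b; move: (\sum_(_ <- _) _) => N; rewrite exprVn [2 ^+ j.+1]exprS; set u := 2 ^+ j in u0 *.
    rewrite ler_pdivlMr // => le; lra.
  rewrite -mulr_sumr.
  have Tb0 : 0 <= T * b ^+ 2 by rewrite mulr_ge0 ?exprn_ge0 // ltW.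
  have := ler_wpM2l Tb0 (sum_half_le J); lra.
have : energy A B <= d * (a * b) +
  \sum_(x <- diffset A B) rep A B x ^+ 2 * (d <= rep A B x)%R%:R.
  rewrite -small -big_split /=; apply: ler_sum => x _.
  have r0 := rep_ge0 A B x.
  by have [dr|dr] := leP d (rep A B x); rewrite ?mulr1 ?mulr0; nra.
move: large; set L := \sum_(j < J) _; set U := \sum_(x <- _) _.
move=> UL EU dL.
have E0 : 0 <= energy A B by apply: sumr_ge0 => x _; apply: sqr_ge0.
have dE9 : d * energy A B <= 9 * T * b ^+ 2 by nra.
have sq : (d * energy A B) ^+ 2 <= (9 * T * b ^+ 2) ^+ 2.
  by rewrite lerXn2r // nnegrE; nra.
have Tb0 : 0 < T * b by rewrite mulr_gt0.
rewrite -(ler_pM2l Tb0) -{1}dEa.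
have -> : d ^+ 2 * a * energy A B ^+ 2 = a * (d * energy A B) ^+ 2 by ring.
have -> : T * b * (81 * T * a * b ^+ 3) = a * (9 * T * b ^+ 2) ^+ 2 by ring.
by rewrite ler_pM2l.
Qed.

Definition energy3 A : R := \sum_(x <- diffset A A) rep A A x ^+ 3.

(** The moment 3 matches the exponent of the level bound, so each of the [J] dyadic layers
    contributes the same [8 T |A|^2]. This is the source of the logarithm. *)
Lemma energy3_bound A T (J : nat) : st_type A T -> (#|` A| < 2 ^ J)%N ->
  energy3 A <= 8 * T * cardR A ^+ 2 * J%:R.
Proof.
move=> stA AJ.
have repJ x : x \in diffset A A -> rep A A x < 2 ^+ J * 1.
  by move=> _; rewrite mulr1; apply: le_lt_trans (rep_le A A x) _;
    rewrite -natrX ltr_nat.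
have := @sum_power_le_layers R R (diffset A A) (rep A A) 2 1 3 J
  ltac:(lra) ltr01 repJ.
(* Starting the layers at 1 loses nothing: [rep] is integer valued, and zeros do not contribute. *)
have -> : \sum_(x <- diffset A A) rep A A x ^+ 3 * (1 <= rep A A x)%R%:R
          = energy3 A.
  apply: eq_bigr => x _; have [_|] := leP 1 (rep A A x).
    by rewrite mulr1.
  have [k ->] := rep_nat A A x; rewrite ltrn1 ltnS leqn0 => /eqP ->.
  by rewrite expr0n /= mul0r.
move=> /le_trans -> //.
rewrite -[J in leRHS]card_ord -sumr_const mulr_sumr; apply: ler_sum => j _.
have := @st_type_level A T A (diffset A A) (2 ^+ j * 1) stA.
rewrite !mulr1 => /(_ (exprn_gt0 _ _)) le.
rewrite [2 ^+ j.+1]exprS exprMn.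
have : 0 < 2 :> R by []. move=> /le; set u := _ ^+ 3; nra.
Qed.

End Energy.

(** * Triangles *)

Section Triangles.
Variable R : realType.
Implicit Types (A B D P Q : {fset R}) (x y z t T : R).

Lemma sum_shift A Q z (g : R -> R) :
  \sum_(q <- Q) (q - z \in A)%:R * g q
  = \sum_(x <- A) (x + z \in Q)%:R * g (x + z).
Proof.
transitivity (\sum_(q <- Q) \sum_(x <- A) (x == q - z)%:R * g (x + z)).
  apply: eq_bigr => q _.
  by rewrite (sum_mem_delta A (q - z) (fun x => g (x + z))) subrK.
rewrite exchange_big /=; apply: eq_bigr => x _.
rewrite -(sum_mem_delta Q (x + z) (fun=> g (x + z))).
by apply: eq_bigr => q _; rewrite eq_sym subr_eq.
Qed.

Definition sum_rep_count A t : R := \sum_(a <- A) (t - a \in A)%:R.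

(** The threshold is half the average number of representations over A + A, so the discarded sums
    account for at most half of the [|A|^2] pairs. *)
Definition popular_sums A : {fset R} :=
  [fset t in sumset A A
    | cardR A ^+ 2 / (2 * cardR (sumset A A)) <= sum_rep_count A t]%fset.

Lemma sum_sumset_shift A x (g : R -> R) : x \in A ->
  \sum_(t <- sumset A A) (t - x \in A)%:R * g t = \sum_(a <- A) g (a + x).
Proof.
move=> xA; rewrite sum_shift big_seq [RHS]big_seq.
by apply: eq_bigr => a aA; rewrite mem_sumset // mul1r.
Qed.

Lemma sum_sum_rep_count A :
  \sum_(t <- sumset A A) sum_rep_count A t = cardR A ^+ 2.
Proof.
rewrite exchange_big /= expr2 {1}cardR_sum mulr_suml big_seq [RHS]big_seq.
apply: eq_bigr => x xA; rewrite mul1r cardR_sum.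
rewrite -(sum_sumset_shift (fun=> 1) xA).
by apply: eq_bigr => t _; rewrite mulr1.
Qed.

Lemma sum_rep_count_ge0 A t : 0 <= sum_rep_count A t.
Proof. by apply: sumr_ge0 => a _; apply: ler0n. Qed.

Lemma sumset_gt0 A : 0 < cardR A -> 0 < cardR (sumset A A).
Proof.
rewrite !ltr0n !cardfs_gt0 => /fset0Pn[a aA]; apply/fset0Pn.
by exists (a + a); apply: mem_sumset.
Qed.

Lemma sum_popular_sums A : 0 < cardR A ->
  cardR A ^+ 2 / 2 <= \sum_(t <- popular_sums A) sum_rep_count A t.
Proof.
move=> a0; have s0 := sumset_gt0 a0.
set d := cardR A ^+ 2 / (2 * cardR (sumset A A)).
rewrite /popular_sums -big_fset_condE big_mkcond /= -/d.
have := sum_sum_rep_count A; have : \sum_(t <- sumset A A) d = cardR A ^+ 2 / 2.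
  under eq_bigr do rewrite -[d]mulr1.
  rewrite -mulr_sumr -cardR_sum /d; field; by rewrite gt_eqF.
have : \sum_(t <- sumset A A) sum_rep_count A t <= \sum_(t <- sumset A A) d +
  \sum_(t <- sumset A A)
     (if d <= sum_rep_count A t then sum_rep_count A t else 0).
  rewrite -big_split /=; apply: ler_sum => t _; rewrite -/d.
  have d0 : 0 <= d by rewrite divr_ge0 ?exprn_ge0 ?mulr_ge0 // ltW.
  by have [|/ltW] := leP d (sum_rep_count A t); rewrite ?addr0 // lerDr.
rewrite -/d; set u := \sum_(t <- _) d.
move: (\sum_(t <- _) (if _ then _ else _)) => v; lra.
Qed.

(* The quantity over triples (x, y, z) of A that the argument estimates in two
   ways, already grouped by q = x + z and q' = y + z. *)
Definition triangles A Q : R :=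
  \sum_(q <- Q) \sum_(q' <- Q)
     rep A A (q - q') * \sum_(z <- A) (q - z \in A)%:R * (q' - z \in A)%:R.

(** This ungrouped form serves the lower bound; the definition serves the upper bound. *)
Lemma trianglesE A Q : triangles A Q =
  \sum_(z <- A) \sum_(x <- A) \sum_(y <- A)
    (x + z \in Q)%:R * (y + z \in Q)%:R * rep A A (x - y).
Proof.
transitivity (\sum_(z <- A) \sum_(q <- Q) (q - z \in A)%:R *
   \sum_(q' <- Q) (q' - z \in A)%:R * rep A A (q - q')).
  rewrite exchange_big /=; apply: eq_bigr => q _.
  rewrite [RHS](eq_bigr (fun z => \sum_(q' <- Q) (q - z \in A)%:R *
     ((q' - z \in A)%:R * rep A A (q - q')))); last first.
    by move=> z _; rewrite mulr_sumr.
  rewrite exchange_big /=; apply: eq_bigr => q' _.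
  by rewrite mulr_sumr; apply: eq_bigr => z _; ring.
apply: eq_bigr => z _; rewrite sum_shift; apply: eq_bigr => x _.
rewrite sum_shift mulr_sumr; apply: eq_bigr => y _.
by rewrite -mulrA opprD addrACA subrr addr0.
Qed.

(* Positive definiteness of [(x, y) |-> rep A A (x - y)] on [A], in the form of
   the Cauchy-Schwarz inequality over the pairs [(t, z)]. *)
Lemma triangles_ge A Q :
  (\sum_(q <- Q) sum_rep_count A q) ^+ 2 * cardR A
  <= cardR (sumset A A) * triangles A Q.
Proof.
set S := sumset A A.
(* For x and y in A, the number of t in A + A with t - x and t - y both in A is r(x - y), so the
   squares of [h] add up to the triangle count. *)
pose h (tz : R * R) : R :=
  \sum_(x <- A) (tz.1 - x \in A)%:R * (x + tz.2 \in Q)%:R.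
pose s := [seq (t, z) | t <- enum_fset S, z <- enum_fset A].
have sumh : \sum_(i <- s) h i * 1 = cardR A * \sum_(q <- Q) sum_rep_count A q.
  rewrite big_allpairs /=.
  under eq_bigr do under eq_bigr do rewrite mulr1 /h /=.
  rewrite exchange_big /=.
  under eq_bigr => z _ do rewrite exchange_big /=.
  transitivity (cardR A * \sum_(z <- A) \sum_(x <- A) (x + z \in Q)%:R).
    rewrite mulr_sumr; apply: eq_bigr => z _.
    rewrite mulr_sumr big_seq [RHS]big_seq; apply: eq_bigr => x xA.
    rewrite (sum_sumset_shift (fun=> _) xA) cardR_sum mulr_suml.
    by apply: eq_bigr => a _; rewrite mul1r.
  congr (_ * _); rewrite [RHS]exchange_big /=.
  apply: eq_bigr => z _; under [RHS]eq_bigr do rewrite -[_%:R]mulr1.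
  by rewrite sum_shift; apply: eq_bigr => x _; rewrite mulr1.
have sum1 : \sum_(i <- s) (1 : R) ^+ 2 = cardR S * cardR A.
  rewrite big_allpairs /= !cardR_sum mulr_suml; apply: eq_bigr => t _.
  by rewrite mul1r; apply: eq_bigr => z _; rewrite expr1n.
have sumh2 : \sum_(i <- s) h i ^+ 2 = triangles A Q.
  rewrite big_allpairs /= trianglesE exchange_big /=; apply: eq_bigr => z _.
  transitivity (\sum_(t <- S) \sum_(x <- A) \sum_(y <- A)
     (t - x \in A)%:R * ((x + z \in Q)%:R * (y + z \in Q)%:R * (t - y \in A)%:R
       : R)).
    apply: eq_bigr => t _; rewrite /h /= expr2 mulr_suml; apply: eq_bigr => x _.
    by rewrite mulr_sumr; apply: eq_bigr => y _; ring.
  rewrite exchange_big /= big_seq [RHS]big_seq; apply: eq_bigr => x xA.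
  rewrite exchange_big /=; apply: eq_bigr => y _.
  rewrite (sum_sumset_shift (fun t => (x + z \in Q)%:R * (y + z \in Q)%:R
    * (t - y \in A)%:R) xA) -mulr_sumr; congr (_ * _).
  by apply: eq_bigr => a _; rewrite -addrA [a + _]addrC.
have := cauchy_schwarz s h (fun=> 1).
rewrite sumh sum1 sumh2 exprMn mulrA [_ * _ * cardR A]mulrAC.
move=> le; have tri0 : 0 <= triangles A Q.
  by rewrite -sumh2; apply: sumr_ge0 => i _; apply: sqr_ge0.
have [A0|/cardR_gt0 a0] := eqVneq A fset0%fset.
  have -> : cardR A = 0 by rewrite A0 /cardR cardfs0.
  by rewrite mulr0 mulr_ge0 ?cardR_ge0.
by rewrite -(ler_pM2r a0); lra.
Qed.

(** Cauchy-Schwarz separates [rep] from the inner count [c q q']. Regrouped by pairs z, w of A, the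
    squares of [c] become squares of [e z w], and [e z w <= rep A A (z - w)] brings in [energy3]. *)
Lemma triangles_le A Q :
  triangles A Q ^+ 2
  <= (\sum_(q <- Q) \sum_(q' <- Q) rep A A (q - q') ^+ 2) * energy3 A.
Proof.
pose c q q' : R := \sum_(z <- A) (q - z \in A)%:R * (q' - z \in A)%:R.
pose s := [seq (q, q') | q <- enum_fset Q, q' <- enum_fset Q].
have := cauchy_schwarz s (fun i => rep A A (i.1 - i.2)) (fun i => c i.1 i.2).
rewrite !big_allpairs /= => /le_trans; apply; apply: ler_wpM2l.
  by do 2!(apply: sumr_ge0 => ? _); apply: sqr_ge0.
have -> : energy3 A = \sum_(z <- A) \sum_(w <- A) rep A A (z - w) ^+ 2.
  rewrite -(sum_rep_mul (fun x => rep A A x ^+ 2) (@mem_diffset R A A)).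
  by apply: eq_bigr => x _; rewrite exprS.
pose e z w : R := \sum_(q <- Q) (q - z \in A)%:R * (q - w \in A)%:R.
have -> : \sum_(q <- Q) \sum_(q' <- Q) c q q' ^+ 2
          = \sum_(z <- A) \sum_(w <- A) e z w ^+ 2.
  transitivity (\sum_(q <- Q) \sum_(q' <- Q) \sum_(z <- A) \sum_(w <- A)
    ((q - z \in A)%:R * (q - w \in A)%:R
     * ((q' - z \in A)%:R * (q' - w \in A)%:R) : R)).
    apply: eq_bigr => q _; apply: eq_bigr => q' _.
    rewrite expr2 mulr_suml; apply: eq_bigr => z _.
    by rewrite mulr_sumr; apply: eq_bigr => w _; ring.
  under eq_bigr => q _ do rewrite exchange_big /=.
  rewrite exchange_big /=; apply: eq_bigr => z _.
  under eq_bigr => q _ do rewrite exchange_big /=.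
  rewrite exchange_big /=; apply: eq_bigr => w _.
  rewrite expr2 mulr_suml; apply: eq_bigr => q _.
  by rewrite mulr_sumr.
apply: ler_sum => z _; apply: ler_sum => w _.
have e0 : 0 <= e z w by apply: sumr_ge0 => q _; rewrite mulr_ge0.
rewrite lerXn2r ?nnegrE ?rep_ge0 //.
rewrite /e sum_shift; apply: ler_sum => x _.
rewrite -addrA [x + (z - w)]addrC.
by case: (x + z \in Q); rewrite ?mul1r ?mul0r.
Qed.

End Triangles.

(** * The sumset of a Szemeredi-Trotter set *)

Section MainBound.
Variable R : realType.
Implicit Types (A B D P Q : {fset R}) (x y z t T : R).

Definition diff_square_sum A Q : R :=
  \sum_(q <- Q) \sum_(q' <- Q) rep A A (q - q') ^+ 2.

(** Both sides count the solutions of q + a = q' + a'. *)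
Lemma energyE_right A Q :
  \sum_(q <- Q) \sum_(q' <- Q) rep A A (q - q') = energy A Q.
Proof.
rewrite energyE; under eq_bigr do rewrite exchange_big /=.
rewrite exchange_big /=; apply: eq_bigr => a _.
rewrite exchange_big /=; apply: eq_bigr => q' _; apply: eq_bigr => q _.
by rewrite addrAC [q + a]addrC addrAC.
Qed.

Lemma energyC A B : energy A B = energy B A.
Proof.
rewrite !energyE exchange_big /=.
by apply: eq_bigr => b _; apply: eq_bigr => a _; rewrite -repN opprB.
Qed.

(** A counted pair gives q = p + q' with p in the popular differences P, and q = a + a' in at least
    [r] ways. The resulting solutions of p - a = a' - q' number the sum of [rep P A x * rep A Q x],
    to which Cauchy-Schwarz applies. *)
Lemma popular_count_le A Q (r d : R) : 0 < d -> 0 <= r ->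
  (forall q, q \in Q -> r <= sum_rep_count A q) ->
  (r * \sum_(q <- Q) \sum_(q' <- Q) (d <= rep A A (q - q'))%R%:R) ^+ 2
  <= energy A [fset x in diffset A A | d <= rep A A x]%fset * energy A Q.
Proof.
move=> d0 r0 rQ; set P := [fset x in _ | _]%fset.
have memP x : (d <= rep A A x) = (x \in P).
  rewrite !inE /=; have [//|/rep_diffset ->] := boolP (x \in diffset A A).
  by rewrite leNgt d0.
pose D := (diffset P A `|` diffset A Q)%fset.
have PA p a : p \in P -> a \in A -> p - a \in D.
  by move=> pP aA; rewrite inE mem_diffset.
have AQ a q : a \in A -> q \in Q -> a - q \in D.
  by move=> aA qQ; rewrite inE orbC mem_diffset.
have le : r * \sum_(q <- Q) \sum_(q' <- Q) (d <= rep A A (q - q'))%R%:R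
          <= \sum_(x <- D) rep P A x * rep A Q x.
  rewrite (sum_rep_mul (rep A Q) PA) exchange_big /= mulr_sumr.
  have -> : \sum_(p <- P) \sum_(a <- A) rep A Q (p - a)
            = \sum_(q' <- Q) \sum_(p <- P) sum_rep_count A (p + q').
    under eq_bigr do rewrite exchange_big /=.
    rewrite exchange_big /=; apply: eq_bigr => q' _.
    apply: eq_bigr => p _; apply: eq_bigr => a _.
    by rewrite addrAC.
  apply: ler_sum => q' _; rewrite mulr_sumr.
  apply: le_trans (_ : \sum_(q <- Q) (q - q' \in P)%:R * sum_rep_count A q <= _).
    apply: ler_sum_mem => q qQ; rewrite memP mulrC.
    by rewrite ler_wpM2l // rQ.
  rewrite sum_shift; apply: ler_sum => p _.
  by have := sum_rep_count_ge0 A (p + q'); case: (_ \in Q); rewrite ?mul1r ?mul0r.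
apply: le_trans (_ : (\sum_(x <- D) rep P A x * rep A Q x) ^+ 2 <= _).
  rewrite lerXn2r ?nnegrE //; last first.
    by apply: sumr_ge0 => x _; rewrite mulr_ge0 // rep_ge0.
  rewrite mulr_ge0 //.
  by do 2!(apply: sumr_ge0 => ? _); apply: ler0n.
apply: le_trans (cauchy_schwarz _ _ _) _.
by rewrite !energy_superset // energyC.
Qed.

Lemma popular_sumsP A q : q \in popular_sums A ->
  cardR A ^+ 2 / (2 * cardR (sumset A A)) <= sum_rep_count A q.
Proof. by rewrite !inE => /andP[]. Qed.

Lemma popular_sums_card A : cardR (popular_sums A) <= cardR (sumset A A).
Proof.
rewrite ler_nat; apply: fsubset_leq_card; apply/fsubsetP => x.
by rewrite !inE => /andP[].
Qed.

(** Both energies are estimated by [energy_bound], with [|P| <= T |A|^2 / d^3] and [|Q| <= |A + A|].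
    The fourth power avoids roots, and [18^4] is [81^2] from the energies times [2^4] from the
    popularity threshold. *)
Lemma popular_count_bound A T (d : R) : st_type A T -> 0 < T -> 0 < d ->
  0 < cardR A ->
  (\sum_(q <- popular_sums A) \sum_(q' <- popular_sums A)
     (d <= rep A A (q - q'))%R%:R) ^+ 4 * d ^+ 9
  <= 18 ^+ 4 * T ^+ 5 * cardR (sumset A A) ^+ 7.
Proof.
move=> stA T0 d0 a0; have s0 := sumset_gt0 a0.
have := popular_sums_card A; set Q := popular_sums A => Qs.
set Y := \sum_(q <- Q) _.
set P := [fset x in diffset A A | d <= rep A A x]%fset.
have r0 : 0 < cardR A ^+ 2 / (2 * cardR (sumset A A)).
  by rewrite divr_gt0 ?exprn_gt0 // mulr_gt0.
have := popular_count_le d0 (ltW r0) (@popular_sumsP A).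
rewrite -/Q -/Y -/P => le.
have EP := energy_bound P stA T0; have EQ := energy_bound Q stA T0.
have dP : d ^+ 3 * cardR P <= T * cardR A ^+ 2.
  by apply: stA => // x; rewrite !inE => /andP[].
move: a0 s0 r0 Qs le EP EQ dP (cardR_ge0 P) (cardR_ge0 Q).
set a := cardR A; set s := cardR (sumset A A); set p := cardR P.
set q := cardR Q; set eP := energy A P; set eQ := energy A Q.
move=> a0 s0 r0 Qs le EP EQ dP p0 q0.
have le4 : (a ^+ 2 / (2 * s) * Y) ^+ 4
           <= (81 * T * a * p ^+ 3) * (81 * T * a * s ^+ 3).
  apply: le_trans (_ : (eP * eQ) ^+ 2 <= _).
    rewrite (exprM _ 2 2); apply: lerXn2r; rewrite ?nnegrE ?sqr_ge0 //.
    by apply: le_trans le; apply: sqr_ge0.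
  rewrite exprMn; apply: ler_pM => //; try exact: sqr_ge0.
  apply: le_trans EQ _; rewrite ler_wpM2l ?mulr_ge0 ?(ltW T0) ?(ltW a0) //.
  by rewrite lerXn2r // nnegrE ltW.
have dP3 : (d ^+ 3 * p) ^+ 3 <= (T * a ^+ 2) ^+ 3.
  by rewrite lerXn2r // nnegrE mulr_ge0 ?exprn_ge0 // ltW.
have E : (a ^+ 2 / (2 * s) * Y) ^+ 4 * (16 * s ^+ 4) = a ^+ 8 * Y ^+ 4.
  by field; rewrite gt_eqF.
have a80 : 0 < a ^+ 8 by rewrite exprn_gt0.
rewrite -(ler_pM2l a80) mulrA -E.
apply: le_trans (_ : (81 * T * a * p ^+ 3) * (81 * T * a * s ^+ 3)
   * (16 * s ^+ 4) * d ^+ 9 <= _).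
  rewrite ler_wpM2r ?exprn_ge0 ?(ltW d0) // ler_wpM2r //.
  by rewrite mulr_ge0 ?exprn_ge0 ?(ltW s0).
have -> : 81 * T * a * p ^+ 3 * (81 * T * a * s ^+ 3) * (16 * s ^+ 4) * d ^+ 9
  = (18 ^+ 4 * T ^+ 2 * a ^+ 2 * s ^+ 7) * (d ^+ 3 * p) ^+ 3 by ring.
have -> : a ^+ 8 * (18 ^+ 4 * T ^+ 5 * s ^+ 7)
  = (18 ^+ 4 * T ^+ 2 * a ^+ 2 * s ^+ 7) * (T * a ^+ 2) ^+ 3 by ring.
by rewrite ler_wpM2l // !mulr_ge0 ?exprn_ge0 ?(ltW a0) ?(ltW s0) ?(ltW T0).
Qed.

(* [16]-adic levels: the level bound decays like [d ^ (-9/4)], so the weights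
   [d ^ 2] leave the convergent series [\sum_j 16 ^ (- j / 4)]. *)
Lemma diff_square_sum_bound A T (e w : R) :
  st_type A T -> 0 < cardR A -> 0 < e -> 0 < w ->
  e ^+ 20 * cardR A ^+ 2 = T ^+ 3 * cardR (sumset A A) ->
  w ^+ 4 = T ^+ 5 * cardR (sumset A A) ^+ 7 ->
  0 < T ->
  e * diff_square_sum A (popular_sums A) <= (9 + 512 * 18) * w.
Proof.
move=> stA a0 e0 w0 eE wE T0; have s0 := sumset_gt0 a0.
have := popular_sums_card A; set Q := popular_sums A => Qs.
pose sq := [seq (q, q') | q <- enum_fset Q, q' <- enum_fset Q].
pose r (i : R * R) := rep A A (i.1 - i.2).
have XE : diff_square_sum A Q = \sum_(i <- sq) r i ^+ 2.
  by rewrite /sq big_allpairs.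
(* Differences are split at [e ^+ 4], whose fourth root keeps the level bound polynomial in [e]. The
   equation for [e ^+ 20] balances the parts: after multiplication by [e] both are of order [w]. *)
have e40 : 0 < e ^+ 4 by rewrite exprn_gt0.
have [J aJ] : exists J : nat, cardR A / e ^+ 4 < 16 ^+ J.
  by apply: exists_exp_gt; lra.
have rJ i : i \in sq -> r i < 16 ^+ J * e ^+ 4.
  by move=> _; apply: le_lt_trans (rep_le _ _ _) _; rewrite -ltr_pdivrMr.
have large := @sum_power_le_layers R _ sq r 16 (e ^+ 4) 2 J
  ltac:(lra) e40 rJ.
have tail : e * \sum_(j < J) (16 ^+ j.+1 * e ^+ 4) ^+ 2
    * \sum_(i <- sq) (16 ^+ j * e ^+ 4 <= r i)%R%:R <= 512 * 18 * w.
  apply: le_trans (_ : \sum_(j < J) 256 * 18 * w * (2^-1) ^+ j <= _).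
    rewrite mulr_sumr; apply: ler_sum => j _.
    have u0 : 0 < 16 ^+ j :> R by rewrite exprn_gt0.
    have := popular_count_bound stA T0 (mulr_gt0 u0 e40) a0; rewrite -/Q.
    have -> : \sum_(i <- sq) (16 ^+ j * e ^+ 4 <= r i)%R%:R =
      \sum_(q <- Q) \sum_(q' <- Q) (16 ^+ j * e ^+ 4 <= rep A A (q - q'))%R%:R
      :> R.
      by rewrite /sq big_allpairs.
    set Y := \sum_(_ <- Q) _.
    have Y0 : 0 <= Y by do 2!(apply: sumr_ge0 => ? _); apply: ler0n.
    have -> : 16 ^+ j = (2 ^+ j) ^+ 4 :> R.
      by rewrite -exprM mulnC exprM; congr (_ ^+ _); ring.
    rewrite exprVn [16 ^+ j.+1]exprS.
    have -> : 16 ^+ j = (2 ^+ j) ^+ 4 :> R.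
      by rewrite -exprM mulnC exprM; congr (_ ^+ _); ring.
    set v := 2 ^+ j; have v0 : 0 < v by rewrite exprn_gt0.
    rewrite -mulrA -wE => le.
    have : (Y * (v * e) ^+ 9) ^+ 4 <= (18 * w) ^+ 4.
      have -> : (Y * (v * e) ^+ 9) ^+ 4 = Y ^+ 4 * (v ^+ 4 * e ^+ 4) ^+ 9 by ring.
      by rewrite [leRHS]exprMn.
    rewrite ler_pXn2r // ?nnegrE; first last.
    - by rewrite mulr_ge0 ?ltW.
    - by rewrite mulr_ge0 ?exprn_ge0 // mulr_ge0 ?ltW.
    move=> le'; rewrite ler_pdivlMr //.
    have -> : e * ((16 * v ^+ 4 * e ^+ 4) ^+ 2 * Y) * v
      = 256 * (Y * (v * e) ^+ 9) by ring.
    by rewrite -mulrA ler_wpM2l.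
  rewrite -mulr_sumr.
  have w18 : 0 <= 256 * 18 * w by rewrite mulr_ge0 // ltW.
  have := ler_wpM2l w18 (sum_half_le R J); lra.
have small : e ^+ 5 * energy A Q <= 9 * w.
  have E0 : 0 <= energy A Q by apply: sumr_ge0 => x _; apply: sqr_ge0.
  rewrite -(@ler_pXn2r _ 4) ?nnegrE //; first last.
  - by rewrite mulr_ge0 // ltW.
  - by rewrite mulr_ge0 ?exprn_ge0 // ltW.
  rewrite [leRHS]exprMn wE.
  have -> : (e ^+ 5 * energy A Q) ^+ 4 = e ^+ 20 * energy A Q ^+ 4 by ring.
  have EQ : energy A Q ^+ 4 <=
      (81 * T * cardR A * cardR (sumset A A) ^+ 3) ^+ 2.
    rewrite (exprM _ 2 2); apply: lerXn2r; rewrite ?nnegrE ?sqr_ge0 //.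
      by rewrite !mulr_ge0 ?exprn_ge0 // ltW.
    apply: le_trans (energy_bound Q stA T0) _.
    rewrite ler_wpM2l ?mulr_ge0 ?(ltW T0) ?(ltW a0) //.
    by rewrite lerXn2r // nnegrE ?cardR_ge0 // ltW.
  apply: le_trans (_ : e ^+ 20 *
      (81 * T * cardR A * cardR (sumset A A) ^+ 3) ^+ 2 <= _).
    by rewrite ler_wpM2l // exprn_ge0 // ltW.
  have -> : e ^+ 20 * (81 * T * cardR A * cardR (sumset A A) ^+ 3) ^+ 2
   = 9 ^+ 4 * T ^+ 2 * cardR (sumset A A) ^+ 6 * (e ^+ 20 * cardR A ^+ 2) by ring.
  by rewrite eE le_eqVlt; apply/orP; left; apply/eqP; ring.
have : diff_square_sum A Q <= e ^+ 4 * energy A Q +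
    \sum_(i <- sq) r i ^+ 2 * (e ^+ 4 <= r i)%R%:R.
  have -> : energy A Q = \sum_(i <- sq) r i.
    by rewrite -energyE_right /sq big_allpairs.
  rewrite XE mulr_sumr -big_split /=; apply: ler_sum => i _.
  have r0 : 0 <= r i by apply: rep_ge0.
  by have [dr|dr] := leP (e ^+ 4) (r i); rewrite ?mulr1 ?mulr0; nra.
move=> /(ler_wpM2l (ltW e0)) /le_trans; apply.
rewrite mulrDr mulrA -exprS mulrDl; apply: lerD => //.
by apply: le_trans tail; rewrite ler_pM2l.
Qed.

(** The two estimates of the triangles give [|A|^10 << |A + A|^2 X E_3], where [X] is the
    [diff_square_sum] of the popular sums; here [E_3 << T |A|^2 J] and [X << w / e]. *)
Lemma st_type_sumset : exists2 K : R, 0 < K &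
  forall A T (J : nat), st_type A T -> 0 < T -> 0 < cardR A ->
    (#|` A| < 2 ^ J)%N ->
    cardR A ^+ 79 <= K * (T ^+ 21 * cardR (sumset A A) ^+ 37 * J%:R ^+ 10).
Proof.
(* The factor 128 is 16, from squaring the lower bound for the triangles, times 8 from
   [energy3_bound]; the other factor is that of [diff_square_sum_bound]. A twentieth power followed
   by a square root leaves exponent 10. *)
exists ((128 * (9 + 512 * 18)) ^+ 10); first by apply: exprn_gt0; lra.
move=> A T J stA T0 a0 AJ; have s0 := sumset_gt0 a0.
have [e e0 eE] : exists2 e : R, 0 < e &
    e ^+ 20 = T ^+ 3 * cardR (sumset A A) / cardR A ^+ 2.
  by apply: root_exists; rewrite // divr_gt0 ?mulr_gt0 ?exprn_gt0.
have [w w0 wE] : exists2 w : R, 0 < w &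
    w ^+ 4 = T ^+ 5 * cardR (sumset A A) ^+ 7.
  by apply: root_exists; rewrite // mulr_gt0 ?exprn_gt0.
have eE' : e ^+ 20 * cardR A ^+ 2 = T ^+ 3 * cardR (sumset A A).
  by rewrite eE divfK // gt_eqF ?exprn_gt0.
have X := diff_square_sum_bound stA a0 e0 w0 eE' wE T0.
have E3 := energy3_bound stA AJ.
have tge := triangles_ge A (popular_sums A).
have tle := triangles_le A (popular_sums A).
have pop := sum_popular_sums a0.
have E30 : 0 <= energy3 A.
  by apply: sumr_ge0 => x _; rewrite exprn_ge0 // rep_ge0.
have X0 : 0 <= diff_square_sum A (popular_sums A).
  by do 2!(apply: sumr_ge0 => ? _); apply: sqr_ge0.
move: a0 s0 eE' wE X E3 tge tle pop E30 X0; rewrite -/(diff_square_sum _ _).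
set K : R := 9 + 512 * 18.
have K0 : 0 < K by rewrite /K; lra.
clearbody K.
set a := cardR A; set s := cardR (sumset A A).
set E := energy3 A; set Y := diff_square_sum _ _; set N := triangles _ _.
set p := \sum_(t <- _) _; set j : R := J%:R.
have j0 : 0 <= j by apply: ler0n.
move=> a0 s0 eE' wE X E3 tge tle pop E30 Y0.
have N1 : a ^+ 5 <= 4 * (s * N).
  have : (a ^+ 2 / 2) ^+ 2 * a <= p ^+ 2 * a.
    rewrite ler_pM2r // lerXn2r // nnegrE.
      by rewrite divr_ge0 ?exprn_ge0 // ltW.
    by apply: le_trans pop; rewrite divr_ge0 ?exprn_ge0 // ltW.
  move=> /le_trans /(_ tge); lra.
have N2 : a ^+ 10 <= 16 * s ^+ 2 * (Y * E).
  apply: le_trans (_ : (4 * (s * N)) ^+ 2 <= _).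
    rewrite (exprM _ 5 2); apply: lerXn2r; rewrite ?nnegrE ?exprn_ge0 ?(ltW a0) //.
    by apply: le_trans N1; rewrite exprn_ge0 // ltW.
  have -> : (4 * (s * N)) ^+ 2 = 16 * s ^+ 2 * N ^+ 2 by ring.
  by rewrite ler_wpM2l // mulr_ge0 ?sqr_ge0.
have N3 : e * a ^+ 8 <= 128 * K * (s ^+ 2 * T * j * w).
  have a20 : 0 < a ^+ 2 by rewrite exprn_gt0.
  rewrite -(ler_pM2r a20).
  have -> : e * a ^+ 8 * a ^+ 2 = e * a ^+ 10 by ring.
  apply: le_trans (_ : e * (16 * s ^+ 2 * (Y * E)) <= _).
    by rewrite ler_pM2l.
  have -> : e * (16 * s ^+ 2 * (Y * E)) = 16 * s ^+ 2 * ((e * Y) * E) by ring.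
  have -> : 128 * K * (s ^+ 2 * T * j * w) * a ^+ 2
    = 16 * s ^+ 2 * ((K * w) * (8 * T * a ^+ 2 * j)) by ring.
  rewrite ler_wpM2l ?mulr_ge0 ?sqr_ge0 //.
  by apply: ler_pM => //; rewrite mulr_ge0 // ltW.
set M := 128 * K in N3 *.
have M0 : 0 < M by rewrite mulr_gt0.
have a79 : 0 <= a ^+ 79 by rewrite exprn_ge0 // ltW.
have rhs0 : 0 <= M ^+ 10 * (T ^+ 21 * s ^+ 37 * j ^+ 10).
  have [T0' s0'] := (ltW T0, ltW s0).
  by do ![apply: mulr_ge0 | apply: exprn_ge0] => //; exact: ltW.
(* The twentieth power of [N3] makes [e] and [w] monomials in [T], [s] and [a]; once [T ^+ 3 * s] is
   cancelled, both sides are squares. *)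
rewrite -(@ler_pXn2r _ 2) ?nnegrE //.
have T3s : 0 < T ^+ 3 * s by rewrite mulr_gt0 ?exprn_gt0.
rewrite -(ler_pM2l T3s).
have -> : T ^+ 3 * s * (a ^+ 79) ^+ 2 = (e * a ^+ 8) ^+ 20.
  by rewrite -eE'; ring.
have -> : T ^+ 3 * s * (M ^+ 10 * (T ^+ 21 * s ^+ 37 * j ^+ 10)) ^+ 2
  = (M * (s ^+ 2 * T * j)) ^+ 20 * (T ^+ 5 * s ^+ 7) ^+ 5 by ring.
rewrite -wE.
have -> : (M * (s ^+ 2 * T * j)) ^+ 20 * (w ^+ 4) ^+ 5
  = (M * (s ^+ 2 * T * j * w)) ^+ 20 by ring.
apply: lerXn2r => //; rewrite nnegrE.
  by rewrite mulr_ge0 ?exprn_ge0 ?(ltW a0) ?(ltW e0).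
by apply: le_trans N3; rewrite mulr_ge0 ?exprn_ge0 ?(ltW a0) ?(ltW e0).
Qed.

End MainBound.

(** * Incidences with translates of a monotone curve *)

Section Incidences.
Variable R : realType.
Implicit Types (A B C F X : {fset R}) (x y : R).

(** Blocks of [s] consecutive elements of X are the fibres of [rank X x %/ s]. *)
Definition rank X x : nat := #|` [fset y in X | y < x]%fset|.

Lemma rank_mono X x y : x \in X -> x < y -> (rank X x < rank X y)%N.
Proof.
move=> xX xy; apply: fproper_ltn_card; rewrite fproperE.
apply/andP; split.
  by apply/fsubsetP => z; rewrite !inE => /andP[-> /lt_trans ->].
apply/negP => /fsubsetP/(_ x).
by rewrite !inE xX xy ltxx => /(_ isT).
Qed.

Lemma rank_lt_card X x : x \in X -> (rank X x < #|` X|)%N.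
Proof.
move=> xX; apply: fproper_ltn_card; rewrite fproperE.
apply/andP; split.
  by apply/fsubsetP => z; rewrite !inE => /andP[].
apply/negP => /fsubsetP/(_ x xX).
by rewrite !inE ltxx andbF.
Qed.

Lemma rank_inj X : {in X &, injective (rank X)}.
Proof.
move=> x y xX yX e.
by have [/(rank_mono xX)|/(rank_mono yX)|//] := ltgtP x y; rewrite e ltnn.
Qed.

Lemma block_card X (s k : nat) : (0 < s)%N ->
  (\sum_(x <- X) (rank X x %/ s == k) <= s)%N.
Proof.
move=> s0; rewrite -big_mkcond /= sum1_count -size_filter.
rewrite -(size_map (rank X)) -[leqRHS](size_iota (k * s)).
apply: uniq_leq_size.
  rewrite map_inj_in_uniq ?filter_uniq ?fset_uniq // => x y.
  by rewrite !mem_filter => /andP[_ xX] /andP[_ yX]; apply: rank_inj.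
move=> _ /mapP[x + ->]; rewrite mem_filter mem_iota => /andP[/eqP <- _].
by rewrite leq_divM addnC -mulSn ltn_ceil.
Qed.

Lemma same_block_card X (s : nat) : (0 < s)%N ->
  (\sum_(x <- X) \sum_(y <- X) (rank X x %/ s == rank X y %/ s)
   <= #|` X| * s)%N.
Proof.
move=> s0; rewrite -sum1_size big_distrl /=; apply: leq_sum => x _.
rewrite mul1n; under eq_bigr do rewrite eq_sym; exact: block_card.
Qed.

(** Points without an earlier point of the same [g]-value have distinct values, so there are at most
    [M] of them; every other point is the later member of some counted pair. *)
Lemma collisions X (p : pred R) (g : R -> nat) (M : nat) :
  (forall x, x \in X -> p x -> (g x < M)%N) ->
  (\sum_(x <- X) p x <= M + \sum_(x <- X) \sum_(y <- X)
     [&& p x, p y, (y < x)%R & g y == g x])%N.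
Proof.
move=> gM.
pose later x := has (fun y => [&& p y, (y < x)%R & g y == g x]) X.
have split_p : (\sum_(x <- X) p x <= \sum_(x <- X) (p x && ~~ later x)
    + \sum_(x <- X) (p x && later x))%N.
  by rewrite -big_split /=; apply: leq_sum => x _; case: (p x); case: (later x).
apply: leq_trans split_p _; apply: leq_add.
  rewrite -big_mkcond /= sum1_count -size_filter.
  rewrite -(size_map g) -[leqRHS](size_iota 0); apply: uniq_leq_size.
    rewrite map_inj_in_uniq ?filter_uniq ?fset_uniq // => x y.
    rewrite !mem_filter => /andP[/andP[px /hasPn lx] xX].
    move=> /andP[/andP[py /hasPn ly] yX] e.
    have [xy|yx|//] := ltgtP x y.
      by have := ly x xX; rewrite px xy e eqxx.
    by have := lx y yX; rewrite py yx e eqxx.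
  move=> _ /mapP[x + ->]; rewrite mem_filter mem_iota add0n.
  by move=> /andP[/andP[px _] xX]; apply: gM.
apply: leq_sum => x _.
have [/hasP[y yX lxy]|_] := boolP (later x); last by rewrite andbF.
by rewrite (big_fsetD1 y) //= lxy; case: (p x).
Qed.

Lemma size_filter_allpairs (S T : eqType) (s : seq S) (t : seq T)
    (P : pred (S * T)) :
  size [seq u <- [seq (i, j) | i <- s, j <- t] | P u]
  = (\sum_(i <- s) \sum_(j <- t) P (i, j))%N.
Proof. by rewrite size_filter -sum1_count big_mkcond /= big_allpairs. Qed.

(* No chord of the graph of f over A is a translate of another one: this makes
   two distinct translates of the graph share at most one point. *)
Definition chords_inj A (f : R -> R) : Prop := forall a a' e e',
  a \in A -> a' \in A -> e \in A -> e' \in A -> a < a' -> e < e' ->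
  a' - a = e' - e -> f a' - f a = f e' - f e -> a = e.

Definition increasing_on A (f : R -> R) : Prop :=
  forall a a', a \in A -> a' \in A -> a < a' -> f a < f a'.

(* The curves are the translates x |-> f (x + b) + c, the points lie in X * F.
   Cut X and F into blocks of s and t consecutive elements.  An increasing curve
   visits at most |X|/s + |F|/t + 1 cells, so all but that many of its points
   share a cell with an earlier one; such a pair of points determines the curve,
   and there are at most |X| s |F| t of them. *)
Lemma incidence_count A B C X (f : R -> R) (s t : nat)
    (F := sumset [fset f a | a in A]%fset C) :
  increasing_on A f -> chords_inj A f -> (0 < s)%N -> (0 < t)%N ->
  (#|` C| * \sum_(b <- B) \sum_(x <- X) (x + b \in A)%R
   <= #|` B| * #|` C| * (#|` X| %/ s + #|` F| %/ t).+1
      + #|` X| * s * (#|` F| * t))%N.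
Proof.
move=> incr chord s0 t0.
pose y b c x : R := f (x + b) + c.
have yF b c x : x + b \in A -> c \in C -> y b c x \in F.
  move=> xbA cC; apply: mem_sumset => //; exact: in_imfset.
pose bX x := (rank X x %/ s)%N; pose bF z := (rank F z %/ t)%N.
(* Both block indices are monotone along an increasing curve, so on one curve their sum already
   determines the cell. *)
pose g b c x := (bX x + bF (y b c x))%N.
pose cond b c x x' :=
  [&& x + b \in A, x' + b \in A, x' < x & g b c x' == g b c x].
have curve b c : c \in C ->
    (\sum_(x <- X) (x + b \in A)%R <= (#|` X| %/ s + #|` F| %/ t).+1
      + \sum_(x <- X) \sum_(x' <- X) cond b c x x')%N.
  move=> cC; apply: collisions => x xX xbA; rewrite ltnS; apply: leq_add.
    by apply: leq_div2r; apply: ltnW; apply: rank_lt_card.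
  by apply: leq_div2r; apply: ltnW; apply: rank_lt_card; apply: yF.
pose W := (\sum_(b <- B) \sum_(c <- C) \sum_(x <- X) \sum_(x' <- X)
             cond b c x x')%N.
apply: (@leq_trans (#|` B| * #|` C| * (#|` X| %/ s + #|` F| %/ t).+1 + W)).
  rewrite big_distrr /= -mulnA -[#|` B|]sum1_size big_distrl /= -big_split /=.
  apply: leq_sum => b _.
  rewrite mul1n -[#|` C|]sum1_size !big_distrl /= -big_split /=.
  rewrite big_seq [leqRHS]big_seq; apply: leq_sum => c cC.
  by rewrite !mul1n; apply: curve.
rewrite leq_add2l.
pose BC := [seq (b, c) | b <- enum_fset B, c <- enum_fset C].
pose XX := [seq (x, x') | x <- enum_fset X, x' <- enum_fset X].
pose FF := [seq (z, z') | z <- enum_fset F, z' <- enum_fset F].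
pose U := [seq u <- [seq (v, w) | v <- BC, w <- XX]
  | cond u.1.1 u.1.2 u.2.1 u.2.2].
pose V := [seq u <- [seq (v, w) | v <- XX, w <- FF]
  | (bX u.1.1 == bX u.1.2) && (bF u.2.1 == bF u.2.2)].
have -> : W = size U.
  rewrite /U size_filter_allpairs /BC big_allpairs; apply: eq_bigr => b _.
  by apply: eq_bigr => c _; rewrite /XX big_allpairs.
apply: (@leq_trans (size V)); last first.
  rewrite /V size_filter_allpairs /=.
  have -> : (\sum_(v <- XX) \sum_(w <- FF)
      ((bX v.1 == bX v.2) && (bF w.1 == bF w.2)) =
    (\sum_(x <- X) \sum_(x' <- X) (bX x == bX x')) *
    (\sum_(z <- F) \sum_(z' <- F) (bF z == bF z')))%N.
    transitivity (\sum_(v <- XX) \sum_(w <- FF)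
      (bX v.1 == bX v.2) * (bF w.1 == bF w.2))%N.
      by apply: eq_bigr => v _; apply: eq_bigr => w _; rewrite mulnb.
    under eq_bigr do rewrite -big_distrr /=.
    by rewrite -big_distrl /= /XX /FF !big_allpairs.
  by apply: leq_mul; apply: same_block_card.
(* Injectivity: two curves through the same pair of points give equal chords over A, so [chords_inj]
   forces b = b1, and then c = c1. *)
pose phi (u : (R * R) * (R * R)) :=
  ((u.2.1, u.2.2), (y u.1.1 u.1.2 u.2.1, y u.1.1 u.1.2 u.2.2)).
rewrite -(size_map phi U); apply: uniq_leq_size.
  rewrite map_inj_in_uniq.
    apply: filter_uniq; apply: allpairs_uniq; try by move=> [? ?] [? ?].
      by apply: allpairs_uniq; rewrite ?fset_uniq // => -[? ?] [? ?].
    by apply: allpairs_uniq; rewrite ?fset_uniq // => -[? ?] [? ?].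
  move=> [[b c] [x x']] [[b1 c1] [x1 x1']].
  rewrite !mem_filter => /andP[/and4P[/= xA x'A lt _] _].
  move=> /andP[/and4P[/= x1A x1'A _ _] _] [e1 e2 e3 e4].
  rewrite -{}e1 in x1A e3 *; rewrite -{}e2 in x1'A e4 *.
  have E : x' + b = x' + b1.
    apply: (chord _ (x + b) _ (x + b1)) => //; rewrite ?ltrD2r //.
      by lra.
    by move: e3 e4; rewrite /y; lra.
  have bb : b = b1 by move: E => /addrI.
  by move: e3; rewrite /y bb => /addrI ->.
move=> _ /mapP[[[b c] [x x']] + ->].
rewrite !mem_filter => /andP[/and4P[/= xA x'A lt /eqP eg]].
move=> /allpairsP[[v w] /= [vBC wXX [ev ew]]].
move: vBC wXX; rewrite -{}ev -{}ew.
move=> /allpairsP[[b1 c1] /= [bB cC [eb ec]]].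
move=> /allpairsP[[x1 x1'] /= [xX x'X [ex ex']]].
rewrite -{}eb -{}ec -{}ex -{}ex' in bB cC xX x'X *.
have ylt : y b c x' < y b c x.
  by rewrite /y ltrD2r; apply: incr; rewrite ?ltrD2r.
have le1 : (bX x' <= bX x)%N.
  by apply: leq_div2r; apply: ltnW; apply: rank_mono.
have le2 : (bF (y b c x') <= bF (y b c x))%N.
  by apply: leq_div2r; apply: ltnW; apply: rank_mono => //; apply: yF.
have [-> ->] : bX x = bX x' /\ bF (y b c x) = bF (y b c x').
  by move: eg le1 le2; rewrite /g; lia.
rewrite !eqxx /=; apply/allpairsP.
exists ((x, x'), (y b c x, y b c x')); split => //=.
  by apply/allpairsP; exists (x, x').
by apply/allpairsP; exists (y b c x, y b c x'); split => //=; apply: yF.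
Qed.

End Incidences.

(** * The Szemeredi-Trotter bound for graphs of increasing functions *)

Section SzemerediTrotter.
Variable R : realType.
Implicit Types (A B C F X : {fset R}) (x y : R) (f : R -> R).

Lemma nat_between (u : R) : 0 <= u -> 
  exists k : nat, [/\ (0 < k)%N, u <= k%:R & k%:R <= u + 1].
Proof.
move=> u0; exists (Num.truncn u).+1; split => //.
  by apply: ltW; apply: truncnS_gt.
by rewrite -natr1 lerD2r truncn_le.
Qed.

Lemma cardR_sumset_ger A B a : a \in A -> cardR B <= cardR (sumset A B).
Proof.
move=> aA; rewrite ler_nat.
have <- : #|` [fset (a + b)%R | b in B]%fset| = #|` B|.
  by apply: card_imfset; apply: addrI.
apply: fsubset_leq_card; apply/fsubsetP => _ /imfsetP[b bB ->].
exact: mem_sumset.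
Qed.

Lemma cardR_sumset_gel A B b : b \in B -> cardR A <= cardR (sumset A B).
Proof.
move=> bB; rewrite ler_nat.
have <- : #|` [fset (a + b)%R | a in A]%fset| = #|` A|.
  by apply: card_imfset; apply: addIr.
apply: fsubset_leq_card; apply/fsubsetP => _ /imfsetP[a aA ->].
exact: mem_sumset.
Qed.

Lemma increasing_card A f : increasing_on A f ->
  #|` [fset f a | a in A]%fset| = #|` A|.
Proof.
move=> incr; apply: card_in_imfset => x y xA yA /= e.
have [xy|yx|//] := ltgtP x y.
  by have := incr x y xA yA xy; rewrite e ltxx.
by have := incr y x yA xA yx; rewrite e ltxx.
Qed.

Lemma monotone_card A f :
  increasing_on A f \/ increasing_on A (fun x => - f x) ->
  #|` [fset f a | a in A]%fset| = #|` A|.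
Proof.
case=> [/increasing_card//|incr]; rewrite -(increasing_card incr).
have -> : [fset - f a | a in A]%fset = [fset - x | x in [fset f a | a in A]]%fset.
  apply/fsetP => x.
  apply/imfsetP/imfsetP => /= [[a aA ->]|[_ /imfsetP[a aA ->] ->]].
    by exists (f a) => //; apply: in_imfset.
  by exists a.
by apply/esym; apply: card_imfset; apply: oppr_inj.
Qed.

(* Block sizes [8 |B| / t] and [8 |F| |B| / (t |X|)] make the staircase term of
   [incidence_count] at most [3/8] of the number of incidences. *)
Lemma st_type_increasing A C f (F := sumset [fset f a | a in A]%fset C) :
  increasing_on A f -> chords_inj A f -> 0 < cardR A -> 0 < cardR C ->
  st_type A (162 * cardR F ^+ 2 / cardR C).
Proof.
move=> incr chord A0 C0 B X t t0 tX.
have [a aA] : exists a, a \in A.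
  by apply/fset0Pn; move: A0; rewrite ltr0n cardfs_gt0.
have [c cC] : exists c, c \in C.
  by apply/fset0Pn; move: C0; rewrite ltr0n cardfs_gt0.
have CF : cardR C <= cardR F.
  by apply: (@cardR_sumset_ger _ _ (f a)); apply: in_imfset.
have AF : cardR A <= cardR F.
  by rewrite /cardR -(increasing_card incr); apply: cardR_sumset_gel cC.
have [->|] := eqVneq X fset0%fset.
  rewrite {1}/cardR cardfs0 mulr0 mulr_ge0 ?sqr_ge0 //.
  by rewrite divr_ge0 ?(ltW C0) // mulr_ge0 ?sqr_ge0.
move=> /[dup] /cardR_gt0 X0 /fset0Pn[x0 x0X].
have tB : t <= cardR B by apply: le_trans (tX _ x0X) (rep_le _ _ _).
have tA : t <= cardR A by apply: le_trans (tX _ x0X) (rep_le_left _ _ _).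
have B0 : 0 < cardR B by apply: lt_le_trans tB.
set I := \sum_(x <- X) rep A B x.
have It : t * cardR X <= I.
  rewrite cardR_sum mulr_sumr; apply: ler_sum_mem => x xX.
  by rewrite mulr1 tX.
have IE : I = (\sum_(b <- B) \sum_(x <- X) (x + b \in A)%R)%N%:R.
  rewrite natr_sum /I exchange_big /=; apply: eq_bigr => b _.
  by rewrite natr_sum.
have IAB : I <= cardR A * cardR B.
  rewrite /I exchange_big /= mulrC [cardR B]cardR_sum mulr_suml.
  apply: ler_sum => b _; rewrite mul1r cardR_sum.
  have -> : \sum_(x <- X) (x + b \in A)%:R = \sum_(u <- A) (u - b \in X)%:R :> R.
    have := sum_shift A X (- b) (fun=> 1); rewrite opprK.
    by under eq_bigr do rewrite mulr1; under [RHS]eq_bigr do rewrite mulr1.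
  by apply: ler_sum => u _; rewrite lern1 leq_b1.
have count s k : (0 < s)%N -> (0 < k)%N -> cardR C * I <=
    cardR B * cardR C * (cardR X / s%:R + cardR F / k%:R + 1)
    + cardR X * s%:R * (cardR F * k%:R).
  move=> s0 k0; have := incidence_count B C X incr chord s0 k0.
  rewrite -(ler_nat R) natrD !natrM -IE -/F -/(cardR C) => /le_trans; apply.
  rewrite lerD2r ler_wpM2l ?mulr_ge0 ?cardR_ge0 //.
  rewrite -natr1 natrD lerD2r.
  by apply: lerD; rewrite ler_pdivlMr ?ltr0n // -natrM ler_nat leq_divM.
move: X0 A0 C0 B0 CF AF tA tB It IAB count {IE tX}.
move: (cardR X) (cardR A) (cardR B) (cardR C) (cardR F) I => m n b c' g I.
move=> m0 n0 c0 b0 cg ng tn tb It IAB count.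
rewrite [leRHS]mulrAC ler_pdivlMr //.
have g0 : 0 < g by apply: lt_le_trans cg.
(* With few incidences the trivial bounds [t <= |A| <= |F|], [t <= |B|] and [|C| <= |F|] suffice.
   Otherwise [|B| <= t |X| / 8] absorbs the one extra cell per curve. *)
have [small|big] := ltP (t * m) (8 * b).
  have tt : t * t <= g * b by apply: ler_pM => //; try exact: ltW; apply: le_trans ng.
  have : t * m * (t * t) <= 8 * b * (g * b).
    by apply: ler_pM => //; rewrite ?mulr_ge0 ?ltW.
  move=> /(ler_wpM2r (ltW c0)) le.
  have : 8 * b * (g * b) * c' <= 8 * b * (g * b) * g.
    by rewrite ler_wpM2l // !mulr_ge0 // ltW.
  have : 0 <= g ^+ 2 * b ^+ 2 by rewrite mulr_ge0 ?sqr_ge0.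
  move: le; lra.
have tm0 : 0 < t * m by rewrite mulr_gt0.
have [s [s0 sl su]] : exists s : nat,
    [/\ (0 < s)%N, 8 * b / t <= s%:R & s%:R <= 8 * b / t + 1].
  by apply: nat_between; rewrite divr_ge0 ?mulr_ge0 ?ltW.
have [k [k0 kl ku]] : exists k : nat,
    [/\ (0 < k)%N, 8 * (g * b) / (t * m) <= k%:R
      & k%:R <= 8 * (g * b) / (t * m) + 1].
  by apply: nat_between; rewrite divr_ge0 ?mulr_ge0 ?ltW.
have := count s k s0 k0.
have : 0 < s%:R :> R by rewrite ltr0n.
have : 0 < k%:R :> R by rewrite ltr0n.
move: (s%:R : R) (k%:R : R) sl su kl ku => {s0 k0 count} u v.
rewrite !ler_pdivrMr // => ul uu vl vu v0 u0.
(* Rounding the block sizes up costs at most a factor 9/8, since [t <= |B|] and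
   [t |X| <= |A| |B| <= |F| |B|]. The final constant is then [81 * 8 / 5], below 162. *)
have uu' : u * t <= 9 * b.
  have := ler_wpM2r (ltW t0) uu; rewrite mulrDl divfK ?gt_eqF //; lra.
have vu' : v * (t * m) <= 9 * (g * b).
  have := ler_wpM2r (ltW tm0) vu; rewrite mulrDl divfK ?gt_eqF //.
  have := ler_wpM2r (ltW b0) ng; lra.
have e1 : b * (m / u) <= t * m / 8.
  by rewrite mulrA ler_pdivrMr //; have := ler_wpM2r (ltW m0) ul; lra.
have e2 : b * (g / v) <= t * m / 8.
  by rewrite mulrA ler_pdivrMr //; lra.
have -> : b * c' * (m / u + g / v + 1)
  = c' * (b * (m / u) + b * (g / v) + b) by ring.
have e3 : b * (m / u) + b * (g / v) + b <= 3 / 8 * (t * m) by lra.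
have := ler_wpM2l (ltW c0) e3; have := ler_wpM2l (ltW c0) It.
move=> h1 h2 h3.
have h4 : 5 / 8 * (c' * (t * m)) <= m * u * (g * v) by lra.
have h5 : (u * t) * (v * (t * m)) <= 9 * b * (9 * (g * b)).
  by apply: ler_pM => //; rewrite ?mulr_ge0 ?ltW.
have := ler_wpM2l (ltW g0) h5.
have := ler_wpM2r (sqr_ge0 t) h4.
have : 0 <= g ^+ 2 * b ^+ 2 by rewrite mulr_ge0 ?sqr_ge0.
lra.
Qed.

End SzemerediTrotter.

(** * Convex functions, logarithms *)

Section Conclusion.
Variable R : realType.
Implicit Types (A B C F X : {fset R}) (x y : R) (f : R -> R).

(** With [T = 162 |F|^2 / |C|], the factor [T^21] supplies [|F|^42 / |C|^21], and [|C| >= |A|]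
    raises the exponent 79 to 100. *)
Lemma increasing_bound : exists2 K : R, 0 < K & forall A C f (J : nat),
  increasing_on A f -> chords_inj A f -> cardR A <= cardR C ->
  (#|` A| < 2 ^ J)%N ->
  cardR A ^+ 100 <= K *
    (cardR (sumset [fset f a | a in A]%fset C) ^+ 42
     * cardR (sumset A A) ^+ 37 * J%:R ^+ 10).
Proof.
have [K K0 bound] := st_type_sumset R.
have q0 : 0 < 162 :> R by [].
exists (K * 162 ^+ 21); first by apply: mulr_gt0 => //; apply: exprn_gt0.
move=> A C f J incr chord AC AJ; set F := sumset _ C.
have F0' : 0 <= cardR F by apply: cardR_ge0.
have S0' := cardR_ge0 (sumset A A).
have j0 : 0 <= J%:R :> R by apply: ler0n.
have stA := st_type_increasing incr chord.
rewrite -/F in stA.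
move: (162 : R) q0 stA => q q0 stA.
have rhs0 : 0 <= K * q ^+ 21 *
    (cardR F ^+ 42 * cardR (sumset A A) ^+ 37 * J%:R ^+ 10).
  apply: mulr_ge0; first by apply: mulr_ge0; rewrite ?exprn_ge0 ?ltW.
  by apply: mulr_ge0; [apply: mulr_ge0|]; apply: exprn_ge0.
have [A0|/cardR_gt0 A0] := eqVneq A fset0%fset.
  by rewrite {1}/cardR {1}A0 cardfs0 expr0n.
have C0 : 0 < cardR C by apply: lt_le_trans AC.
have F0 : 0 < cardR F.
  apply: lt_le_trans C0 _; move: A0.
  rewrite ltr0n cardfs_gt0 => /fset0Pn[a aA].
  by apply: (@cardR_sumset_ger _ _ _ (f a)); apply: in_imfset.
have T0 : 0 < q * cardR F ^+ 2 / cardR C.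
  by apply: divr_gt0 => //; apply: mulr_gt0 => //; apply: exprn_gt0.
have := bound A _ J (stA C A0 C0) T0 A0 AJ.
move: A0 C0 F0 AC {rhs0 T0 stA S0' F0'}.
move: (cardR A) (cardR C) (cardR F) => a c g a0 c0 g0 ac.
set s := cardR _; set j : R := J%:R.
move=> le; apply: le_trans (_ : a ^+ 79 * c ^+ 21 <= _).
  have -> : a ^+ 100 = a ^+ 79 * a ^+ 21 by rewrite -exprD.
  by rewrite ler_pM2l ?exprn_gt0 // lerXn2r // nnegrE ltW.
have c21 : 0 < c ^+ 21 by apply: exprn_gt0.
apply: le_trans (ler_wpM2r (ltW c21) le) _.
rewrite le_eqVlt; apply/orP; left; apply/eqP.
rewrite [(_ / c) ^+ 21]exprMn exprVn [(q * _) ^+ 21]exprMn.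
rewrite -[(g ^+ 2) ^+ 21]exprM.
move: (c ^+ 21) c21 (q ^+ 21) (g ^+ _) (s ^+ 37) (j ^+ 10).
by move=> c' c'0 *; field; rewrite gt_eqF.
Qed.

Definition oppset A : {fset R} := [fset - a | a in A]%fset.

Lemma card_oppset A : #|` oppset A| = #|` A|.
Proof. by apply: card_imfset; apply: oppr_inj. Qed.

(** For decreasing [f], passing to [- f] and [- C] negates f(A) + C and keeps its cardinality. *)
Lemma monotone_bound : exists2 K : R, 0 < K & forall A C f (J : nat),
  increasing_on A f \/ increasing_on A (fun x => - f x) ->
  chords_inj A f -> cardR A <= cardR C -> (#|` A| < 2 ^ J)%N ->
  cardR A ^+ 100 <= K *
    (cardR (sumset [fset f a | a in A]%fset C) ^+ 42
     * cardR (sumset A A) ^+ 37 * J%:R ^+ 10).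
Proof.
have [K K0 bound] := increasing_bound; exists K => // A C f J.
case=> [|incr] chord AC AJ; first exact: bound.
have chordN : chords_inj A (fun x => - f x).
  move=> a a' e e' aA a'A eA e'A aa' ee' E1 E2.
  by apply: (chord a a' e e') => //; lra.
have := bound A (oppset C) _ J incr chordN.
rewrite [cardR (oppset C)]/cardR card_oppset => /(_ AC AJ) /le_trans; apply.
rewrite [cardR (sumset _ (oppset C))]/cardR.
suff -> : sumset [fset - f a | a in A]%fset (oppset C)
          = oppset (sumset [fset f a | a in A]%fset C) by rewrite card_oppset.
apply/fsetP => x; apply/idP/idP.
  move=> /imfset2P[_ /imfsetP[a aA ->] [_ /imfsetP[c cC ->] ->]] /=.
  apply/imfsetP; exists (f a + c); last by rewrite opprD.
  by apply: mem_sumset => //; apply: in_imfset.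
move=> /imfsetP[_ /imfset2P[_ /imfsetP[a aA ->] [c cC ->]] ->] /=.
by rewrite opprD; apply: mem_sumset; apply: in_imfset.
Qed.

Lemma sumset_subset A A' B B' : (A' `<=` A)%fset -> (B' `<=` B)%fset ->
  cardR (sumset A' B') <= cardR (sumset A B).
Proof.
move=> /fsubsetP AA /fsubsetP BB; rewrite ler_nat; apply: fsubset_leq_card.
apply/fsubsetP => _ /imfset2P[a aA [b bB ->]].
by apply: mem_sumset; [apply: AA | apply: BB].
Qed.

Lemma strictly_convex_three f x y z : strictly_convex f -> x < y -> y < z ->
  f y * (z - x) < (z - y) * f x + (y - x) * f z.
Proof.
move=> conv xy yz; have xz : 0 < z - x by rewrite subr_gt0 (lt_trans xy).
have t0 : 0 < (z - y) / (z - x) by rewrite divr_gt0 // subr_gt0.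
have t1 : (z - y) / (z - x) < 1 by rewrite ltr_pdivrMr // mul1r ltrD2l ltrN2.
have xz_neq : x != z by rewrite lt_eqF // (lt_trans xy).
have := conv x z ((z - y) / (z - x)) xz_neq t0 t1.
have -> : (z - y) / (z - x) * x + (1 - (z - y) / (z - x)) * z = y.
  by field; rewrite gt_eqF.
rewrite -(ltr_pM2r xz) => /lt_le_trans; apply.
rewrite le_eqVlt; apply/orP; left; apply/eqP.
by field; rewrite gt_eqF.
Qed.

(** The increment of a strictly convex function over an interval of fixed length grows strictly with
    its position: the three-point inequalities at the two inner points have complementary weights
    and are added. *)
Lemma strictly_convex_chords A f : strictly_convex f -> chords_inj A f.
Proof.
move=> conv.
have step a a' e e' : a < a' -> e < e' -> a < e -> a' - a = e' - e ->
    f a' - f a < f e' - f e.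
  move=> aa' ee' ae E.
  have a'e' : a' < e' by lra.
  have h1 := strictly_convex_three conv ae ee'.
  have h2 := strictly_convex_three conv aa' a'e'.
  have ae' : 0 < e' - a by lra.
  rewrite -(ltr_pM2r ae').
  have ee : e' = a' - a + e by lra.
  subst e'; nra.
move=> a a' e e' _ _ _ _ aa' ee' E1 E2.
have [ae|ea|//] := ltgtP a e.
  by have := step a a' e e' aa' ee' ae E1; lra.
by have := step e e' a a' ee' aa' ea (esym E1); lra.
Qed.

(* Past a point where [f] does not exceed an earlier value it increases; the
   remaining points are exactly those at which [f] sets a new strict minimum. *)
Lemma strictly_convex_monotone_half A f : strictly_convex f ->
  exists A', [/\ (A' `<=` A)%fset, cardR A <= 2 * cardR A'
    & increasing_on A' f \/ increasing_on A' (fun x => - f x)].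
Proof.
move=> conv.
pose up a := has (fun b => (b < a) && (f b <= f a)) A.
pose U := [fset a in A | up a]%fset; pose D := [fset a in A | ~~ up a]%fset.
have incrU : increasing_on U f.
  move=> a a'; rewrite !inE => /andP[_ /hasP[b _ /andP[ba fba]]] _ aa'.
  have := strictly_convex_three conv ba aa'; nra.
have incrD : increasing_on D (fun x => - f x).
  move=> a a'; rewrite !inE => /andP[aA _] /andP[_ /hasPn/(_ a aA)] + aa'.
  by rewrite aa' /= -ltNge ltrN2.
have UDA : cardR A = cardR U + cardR D.
  rewrite (cardR_filter A up) (cardR_filter A (fun a => ~~ up a)) cardR_sum.
  rewrite -big_split /=; apply: eq_bigr => a _.
  by case: (up a); rewrite ?addr0 ?add0r.
have [UD|DU] := leP (cardR D) (cardR U).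
  exists U; split; [|lra|by left].
  by apply/fsubsetP => a; rewrite !inE => /andP[].
exists D; split; [|lra|by right].
by apply/fsubsetP => a; rewrite !inE => /andP[].
Qed.

Lemma convex_or_concave_half A f : strictly_convex f \/ strictly_concave f ->
  exists A', [/\ (A' `<=` A)%fset, cardR A <= 2 * cardR A',
    increasing_on A' f \/ increasing_on A' (fun x => - f x)
    & chords_inj A' f].
Proof.
case=> [conv|conc].
  have [A' [sub half mono]] := strictly_convex_monotone_half A conv.
  by exists A'; split => //; apply: strictly_convex_chords.
have conv : strictly_convex (fun x => - f x).
  by move=> x y t xy t0 t1; have := conc x y t xy t0 t1; lra.
have [A' [sub half mono]] := strictly_convex_monotone_half A conv.
exists A'; split => //.
  case: mono => [|incr]; [by right | left => a a' aA a'A aa'].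
  by have := incr a a' aA a'A aa'; rewrite !opprK.
move=> a a' e e' aA a'A eA e'A aa' ee' E1 E2.
apply: (@strictly_convex_chords A' _ conv a a' e e') => //; lra.
Qed.

(** For n at least 2 the truncated logarithm is at least 1, so the additional dyadic layer costs
    only a factor 2. *)
Lemma trunc_log_le_log2 (n : nat) : (1 < n)%N ->
  ((trunc_log 2 n).+1)%:R <= 2 * log2 (n%:R : R) /\ 1 <= log2 (n%:R : R).
Proof.
move=> n1; set k := trunc_log 2 n.
have ln2 : 0 < ln 2 :> R by apply: ln_gt0; lra.
have kn : (2 ^ k <= n)%N by apply: trunc_logP => //; apply: ltnW.
have k1 : (1 <= k)%N by rewrite trunc_log_gt0.
have kle : k%:R <= log2 (n%:R : R).
  rewrite /log2 ler_pdivlMr // mulrC mulr_natr -lnXn ?ltr0n //.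
  by rewrite ler_ln ?posrE ?exprn_gt0 ?ltr0n ?(ltnW n1) // -natrX ler_nat.
have k1R : 1 <= k%:R :> R by rewrite ler1n.
rewrite -natr1; split; lra.
Qed.

(** This returns from a large part A' to A. The factor 4 covers both the monotone half of A and, for
    products, [|A| <= 1 + 2 |A'|] with [|A| >= 2]. *)
Lemma log2_exp_le (K : R) : 0 < K -> exists2 c : R, 0 < c &
  forall A A' (P : R), 0 <= P -> (A' `<=` A)%fset ->
    (1 < #|` A|)%N -> cardR A <= 4 * cardR A' ->
    (forall J : nat, (#|` A'| < 2 ^ J)%N ->
      cardR A' ^+ 100 <= K * (P * J%:R ^+ 10)) ->
    c * (cardR A ^+ 100 * log2 (cardR A) ^- 20) <= P.
Proof.
move=> K0.
have u0 : 0 < 2 ^+ 10 :> R by apply: exprn_gt0.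
have v0 : 0 < 4 ^+ 100 :> R by apply: exprn_gt0.
exists (K * 2 ^+ 10 * 4 ^+ 100)^-1.
  by rewrite invr_gt0; apply: mulr_gt0 => //; apply: mulr_gt0.
move=> A A' P P0 sub n1 large bound.
have [le1 le2] := trunc_log_le_log2 n1; rewrite -/(cardR A) in le1 le2.
have := bound (trunc_log 2 #|` A|).+1.
have lt : (#|` A'| < 2 ^ (trunc_log 2 #|` A|).+1)%N.
  by apply: leq_ltn_trans (fsubset_leq_card sub) _; apply: trunc_log_ltn.
move=> /(_ lt) {lt bound}.
move: large le1 le2 (ler0n R (trunc_log 2 #|` A|).+1) (cardR_ge0 A) (cardR_ge0 A').
move: ((trunc_log 2 #|` A|).+1%:R : R) (cardR A) (cardR A') => j a b.
move: (log2 a) => l ab jl l1 j0 a0 b0 le.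
have l0 : 0 < l by apply: lt_le_trans l1.
have le_a : a ^+ 100 <= 4 ^+ 100 * (K * (P * j ^+ 10)).
  apply: le_trans (_ : (4 * b) ^+ 100 <= _).
    by apply: lerXn2r; rewrite ?nnegrE ?mulr_ge0.
  by rewrite exprMn ler_pM2l.
(* Since [l >= 1], its tenth power is at most its twentieth. *)
have le_j : j ^+ 10 <= 2 ^+ 10 * l ^+ 20.
  apply: le_trans (_ : (2 * l) ^+ 10 <= _).
    by apply: lerXn2r; rewrite ?nnegrE ?mulr_ge0 // ltW.
  by rewrite exprMn ler_pM2l // ler_weXn2l.
have l20 : 0 < l ^+ 20 by apply: exprn_gt0.
move: (4 ^+ 100) (2 ^+ 10) (a ^+ 100) (l ^+ 20) (j ^+ 10) u0 v0 l20 le_a le_j.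
move=> v u n m k u0 v0 m0 le_a le_j.
have W0 : 0 < K * u * v by apply: mulr_gt0 => //; apply: mulr_gt0.
rewrite mulrC ler_pdivrMr // ler_pdivrMr //; apply: le_trans le_a _.
have -> : P * (K * u * v) * m = v * (K * (P * (u * m))) by ring.
by rewrite ler_pM2l // ler_pM2l // ler_wpM2l.
Qed.

Lemma log2_cardR_small A : (#|` A| <= 1)%N -> log2 (cardR A) = 0.
Proof.
rewrite /log2 /cardR; case: #|` A| => [|[|//]] _; first by rewrite ln0 ?mul0r.
by rewrite ln1 mul0r.
Qed.

(** The comparison with [|C|] concerns only subsets on which [f] is monotone, hence injective. This
    admits C = f(A), which may be smaller than A. *)
Lemma convex_sumset_bound : exists2 c : R, 0 < c & forall f A C,
  strictly_convex f \/ strictly_concave f ->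
  (forall A', (A' `<=` A)%fset ->
    increasing_on A' f \/ increasing_on A' (fun x => - f x) ->
    cardR A' <= cardR C) ->
  (1 < #|` A|)%N ->
  c * (cardR A ^+ 100 * log2 (cardR A) ^- 20)
    <= cardR (sumset [fset f a | a in A]%fset C) ^+ 42
       * cardR (sumset A A) ^+ 37.
Proof.
have [K K0 bound] := monotone_bound; have [c c0 final] := log2_exp_le K0.
exists c => // f A C cf AC n1.
have [A' [sub half mono chord]] := convex_or_concave_half A cf.
apply: (final A A') => // [||J AJ].
- by rewrite mulr_ge0 ?exprn_ge0 ?cardR_ge0.
- by have := cardR_ge0 A'; lra.
apply: le_trans (bound A' C f J mono chord (AC A' sub mono) AJ) _.
rewrite ler_pM2l // ler_wpM2r ?exprn_ge0 //.
apply: ler_pM; rewrite ?exprn_ge0 ?cardR_ge0 //;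
  rewrite lerXn2r ?nnegrE ?cardR_ge0 //; apply: sumset_subset => //.
apply/fsubsetP => _ /imfsetP[a aA ->].
by apply: in_imfset; apply: (fsubsetP sub).
Qed.

End Conclusion.

(** * Products, through the logarithm *)

Section Products.
Variable R : realType.
Implicit Types (A B : {fset R}).

Definition lnabs (x : R) : R := ln `|x|.

Lemma lnabsM (x y : R) : x != 0 -> y != 0 -> lnabs (x * y) = lnabs x + lnabs y.
Proof. by move=> x0 y0; rewrite /lnabs normrM lnM // posrE normr_gt0. Qed.

Lemma lnabs_pos (x : R) : 0 < x -> lnabs x = ln x.
Proof. by move=> x0; rewrite /lnabs gtr0_norm. Qed.

Lemma lnabs_neg (x : R) : x < 0 -> lnabs x = ln (- x).
Proof. by move=> x0; rewrite /lnabs ltr0_norm. Qed.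

(** Equal logarithmic increments mean a' / a = e' / e, and equal ratios with equal nonzero
    differences force a = e. *)
Lemma ln_chord (a a' e e' : R) : 0 < a -> 0 < a' -> 0 < e -> 0 < e' ->
  a != a' -> a' - a = e' - e -> ln a' - ln a = ln e' - ln e -> a = e.
Proof.
move=> a0 a'0 e0 e'0 aa' E1 E2.
have /ln_inj E : ln (a' * e) = ln (e' * a) by rewrite !lnM ?posrE //; lra.
have {}E : a' * e = e' * a by apply: E; rewrite posrE mulr_gt0.
have aa'0 : a' - a != 0 by rewrite subr_eq0 eq_sym.
apply: (mulfI aa'0).
have e'E : e' = a' - a + e by lra.
by subst e'; lra.
Qed.

(** The summand 1 accounts for a possible zero in A. *)
Lemma same_sign_part A : exists A', [/\ (A' `<=` A)%fset,
  cardR A <= 1 + 2 * cardR A' &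
  (forall a, a \in A' -> 0 < a) \/ (forall a, a \in A' -> a < 0)].
Proof.
pose P := [fset a in A | 0 < a]%fset; pose N := [fset a in A | a < 0]%fset.
have APN : cardR A <= 1 + cardR P + cardR N.
  rewrite (cardR_filter A (fun a => 0 < a)) (cardR_filter A (fun a => a < 0)).
  apply: le_trans (_ : \sum_(a <- A)
    ((a == 0)%:R * 1 + (0 < a)%R%:R + (a < 0)%R%:R) <= _).
    rewrite cardR_sum; apply: ler_sum => a _.
    by have [a0|a0|_] := ltgtP a 0; rewrite /= ?mulr1; lra.
  rewrite !big_split /= !lerD2r (sum_mem_delta A 0 (fun=> 1)).
  by rewrite mulr1 lern1 leq_b1.
have [NP|PN] := leP (cardR N) (cardR P).
  exists P; split; [|lra|left] => [|a]; last by rewrite !inE => /andP[].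
  by apply/fsubsetP => a; rewrite !inE => /andP[].
exists N; split; [|lra|right] => [|a]; last by rewrite !inE => /andP[].
by apply/fsubsetP => a; rewrite !inE => /andP[].
Qed.

(** On a part of one sign [lnabs] is monotone. With C = [lnabs] (A'), the set [lnabs] (A') + C lies
    in the image of AA under [lnabs], so it has at most |AA| elements. *)
Lemma prodset_sumset_bound : exists2 c : R, 0 < c & forall A,
  (1 < #|` A|)%N ->
  c * (cardR A ^+ 100 * log2 (cardR A) ^- 20)
    <= cardR (prodset A A) ^+ 42 * cardR (sumset A A) ^+ 37.
Proof.
have [K K0 bound] := monotone_bound R; have [c c0 final] := log2_exp_le K0.
exists c => // A n1; have [A' [sub half sign]] := same_sign_part A.
have A2 : 2 <= cardR A by rewrite /cardR ler_nat.
have neq0 a : a \in A' -> a != 0.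
  by case: sign => sg /sg a0; rewrite neq_lt a0 ?orbT.
have mono : increasing_on A' lnabs \/ increasing_on A' (fun x => - lnabs x).
  case: sign => sg; [left|right] => a a' /sg a0 /sg a'0 aa'.
    by rewrite !lnabs_pos // ltr_ln ?posrE.
  by rewrite !lnabs_neg // ltrN2 ltr_ln ?posrE ?oppr_gt0 // ltrN2.
have card_ln : cardR A' <= cardR [fset lnabs a | a in A']%fset.
  by rewrite /cardR (monotone_card mono).
have chord : chords_inj A' lnabs.
  move=> a a' e e' aA a'A eA e'A aa' ee' E1.
  case: sign => sg.
    rewrite !lnabs_pos ?sg // => E2.
    by apply: (ln_chord _ _ _ _ _ E1 E2); rewrite ?sg // lt_eqF.
  rewrite !lnabs_neg ?sg // => E2; apply: oppr_inj.
  apply: (ln_chord _ _ _ _ _ _ E2); rewrite ?oppr_gt0 ?sg //; last by lra.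
  by rewrite eqr_opp lt_eqF.
apply: (final A A') => // [||J AJ].
- by rewrite mulr_ge0 ?exprn_ge0 ?cardR_ge0.
- lra.
apply: le_trans (bound A' _ lnabs J mono chord card_ln AJ) _.
rewrite ler_pM2l // ler_wpM2r ?exprn_ge0 //.
apply: ler_pM; rewrite ?exprn_ge0 ?cardR_ge0 //;
  rewrite lerXn2r ?nnegrE ?cardR_ge0 //; last exact: sumset_subset.
rewrite ler_nat.
have image_le : (#|` [fset lnabs x | x in prodset A A]%fset|
    <= #|` prodset A A|)%N by exact: leq_imfset_card.
apply: leq_trans image_le.
apply: fsubset_leq_card; apply/fsubsetP => z.
move=> /imfset2P[_ /imfsetP[a aA ->] [_ /imfsetP[b bA ->] ->]] /=.
rewrite -lnabsM ?neq0 //.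
apply: in_imfset; apply/imfset2P; exists a; first exact: (fsubsetP sub).
by exists b => //; apply: (fsubsetP sub).
Qed.

End Products.

(** * The three estimates for arbitrary finite sets *)

Theorem theorem4 (R : realType) :
  (exists c : R, 0 < c /\
     forall f : R -> R, continuous f -> strictly_convex f \/ strictly_concave f ->
     forall A C : {fset R}, #|` A|%fset = #|` C|%fset ->
       c * (cardR A ^+ 100 * log2 (cardR A) ^- 20)
         <= cardR (sumset [fset f a | a in A]%fset C) ^+ 42 * cardR (sumset A A) ^+ 37) /\
  (exists c : R, 0 < c /\
     forall f : R -> R, continuous f -> strictly_convex f \/ strictly_concave f ->
     forall A : {fset R},
       c * (cardR A `^ (100 / 79) * log2 (cardR A) `^ (- (20 / 79)))
         <= Num.max
              (cardR (sumset [fset f a | a in A]%fset [fset f a | a in A]%fset))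
              (cardR (sumset A A))) /\
  (exists c : R, 0 < c /\
     forall A : {fset R},
       c * (cardR A ^+ 100 * log2 (cardR A) ^- 20)
         <= cardR (prodset A A) ^+ 42 * cardR (sumset A A) ^+ 37).
Proof.
have [c c0 convex_bound] := convex_sumset_bound R.
have [p p0 product_bound] := prodset_sumset_bound R.
(* With at most one element the logarithm is 0, and so is its inverse power by [invr0]: the lower
   bound is 0. *)
have small (A : {fset R}) (k P : R) : (#|` A| <= 1)%N -> 0 <= P ->
    k * (cardR A ^+ 100 * log2 (cardR A) ^- 20) <= P.
  by move=> n1; rewrite log2_cardR_small // expr0n /= invr0 !mulr0.
have rhs0 (X Y : {fset R}) : 0 <= cardR X ^+ 42 * cardR Y ^+ 37.
  by apply: mulr_ge0; apply: exprn_ge0; apply: cardR_ge0.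
split; [|split].
- exists c; split => // f _ cf A C AC.
  have [n1|n1] := leqP #|` A| 1; first exact: small.
  apply: convex_bound => // A' sub _.
  by rewrite ler_nat -AC fsubset_leq_card.
(* Both sumsets have at most [m] elements and 42 + 37 = 79, so the second estimate is the 79th root
   of the first with C = f(A). *)
- have [d d0 dE] : exists2 d : R, 0 < d & d ^+ 79 = c by exact: root_exists.
  exists d; split => // f _ cf A.
  set F := [fset f a | a in A]%fset.
  set m := Num.max _ _.
  have mF : cardR (sumset F F) <= m by rewrite le_max lexx.
  have mS : cardR (sumset A A) <= m by rewrite le_max lexx orbT.
  have m0 : 0 <= m by apply: le_trans mF; apply: cardR_ge0.
  have [n1|n1] := leqP #|` A| 1.
    by rewrite log2_cardR_small // powR0 ?mulr0 ?mulr0.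
  have [_ l1] := trunc_log_le_log2 R n1; rewrite -/(cardR A) in l1.
  have l0 : 0 <= log2 (cardR A) by apply: le_trans l1.
  have le : c * (cardR A ^+ 100 * log2 (cardR A) ^- 20) <= m ^+ 79.
    apply: le_trans (convex_bound f A F cf _ n1) _.
      move=> A' sub mono.
      apply: le_trans (_ : cardR [fset f a | a in A']%fset <= _); last first.
        rewrite ler_nat; apply: fsubset_leq_card; apply/fsubsetP.
        move=> _ /imfsetP[a aA ->]; apply: in_imfset; exact: (fsubsetP sub).
      by rewrite /cardR (monotone_card mono).
    have -> : m ^+ 79 = m ^+ 42 * m ^+ 37 by rewrite -exprD.
    by apply: ler_pM; rewrite ?exprn_ge0 ?cardR_ge0 //;
      apply: lerXn2r; rewrite ?nnegrE ?cardR_ge0.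
  rewrite -(@ler_pXn2r _ 79) ?nnegrE //; last first.
    by apply: mulr_ge0; [exact: ltW | apply: mulr_ge0; apply: powR_ge0].
  apply: le_trans le; rewrite exprMn dE ler_pM2l // exprMn.
  rewrite -!powR_mulrn ?powR_ge0 // -!powRrM.
  rewrite le_eqVlt; apply/orP; left; apply/eqP.
  congr (_ * _); last first.
    by rewrite -powRN; congr (_ `^ _); field.
  by congr (_ `^ _); field.
- exists p; split => // A.
  have [n1|n1] := leqP #|` A| 1; first exact: small.
  exact: product_bound.
Qed.
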